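(* Let $(\lambda_n)_{n\geq 1}$ be a sequence in the open unit disk $\mathbb{D}$ with $\sum_{n\ge 1}(1-|\lambda_n|)=\infty$. Define $B_0=1$ and $B_n(z)=\prod_{k=1}^n \frac{\lambda_k-z}{1-\overline{\lambda}_k z}$ for $n\ge 1$. Then, for each $f\in \mathrm{Hol}(\overline{\mathbb{D}})$, there exists a unique sequence of complex numbers $(a_n)_{n\geq 0}$ such that $$f=\sum_{n=0}^\infty a_nB_n,$$ where the series converges uniformly on $\overline{\mathbb{D}}$, and the coefficients are given by $$a_n = (T_{\overline{B}_{n}}f)(\lambda_{n+1}) - \overline{\lambda}_n\, (T_{\overline{B}_{n-1}}f)(\lambda_n),\qquad n\geq 0,$$ with the convention $B_{-1}=0$ (so that the second term is $0$ for $n=0$). In particular, the sequence $(B_n)_{n\geq 0}$ is a Schauder basis for $\mathrm{Hol}(\overline{\mathbb{D}})$ equipped with the $H^\infty$-norm $\|f\|_\infty=\sup_{z\in\mathbb{D}}|f(z)|$.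
   Context: $\mathbb{D}$ is the open unit disk of $\mathbb{C}$, $\mathbb{T}$ the unit circle, and $m$ the normalized Lebesgue measure on $\mathbb{T}$. $\mathrm{Hol}(\overline{\mathbb{D}})$ is the space of functions analytic in a neighborhood of $\overline{\mathbb{D}}$. A sequence $(x_n)_{n\ge 0}$ in a complex topological linear space $\mathcal{X}$ is a Schauder basis for $\mathcal{X}$ if for each $x\in\mathcal{X}$ there is a unique sequence $(a_n)_{n\ge 0}$ of complex numbers such that $x=\sum_{n=0}^\infty a_nx_n$, with convergence in the topology of $\mathcal{X}$. For $\varphi\in L^\infty(\mathbb{T})$, the Toeplitz operator is $T_\varphi f=P(\varphi f)$, where $P$ is the Riesz projection $P\left(\sum_{n\in\mathbb{Z}} c_ne^{in\theta}\right)=\sum_{n\ge 0}c_ne^{in\theta}$; thus, as an analytic function on $\mathbb{D}$, $T_\varphi f(z)=\int_{\mathbb{T}}\frac{\varphi(\zeta)f(\zeta)}{1-z\overline{\zeta}}\,dm(\zeta)$. $\overline{B}_n$ denotes the complex conjugate of $B_n$ on $\mathbb{T}$. *)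

(* Defs.v *)
From HB Require Import structures.
From mathcomp Require Import all_boot all_order all_algebra.
From mathcomp Require Import all_classical all_reals all_analysis.
From mathcomp Require Import complex.

Set Implicit Arguments.
Unset Strict Implicit.
Unset Printing Implicit Defensive.

Import Order.TTheory GRing.Theory Num.Theory.
Import numFieldNormedType.Exports.

Local Open Scope classical_set_scope.
Local Open Scope ring_scope.
Local Open Scope complex_scope.

(* The analysis library puts the norm, the topology and the module-over-itself
   structure of a numFieldType K on its regular copy K^o. *)
Notation Cplx R := (R[i])^o.

Definition unit_disk (R : realType) : set (Cplx R) := [set z | `|z| < 1].
Definition closed_disk (R : realType) : set (Cplx R) := [set z | `|z| <= 1].

Definition hol_cdisk (R : realType) (f : Cplx R -> Cplx R) : Prop :=
  exists U : set (Cplx R),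
    [/\ open U, @closed_disk R `<=` U & forall z, U z -> derivable f z 1].

Definition schauder_basis (R : realType) (X : topologicalLmodType R[i])
    (x_ : nat -> X) : Prop :=
  forall x : X, exists! a : nat -> R[i],
    (fun N => \sum_(0 <= n < N) a n *: x_ n) @ \oo --> x.

(* The sequence lam is indexed from 1; the value lam 0 is never used. *)
Definition blaschke (R : realType) (lam : nat -> Cplx R) (n : nat)
    (z : Cplx R) : Cplx R :=
  \prod_(1 <= k < n.+1) ((lam k - z) / (1 - conjc (lam k) * z)).

Definition expi (R : realType) (t : R) : Cplx R := cos t +i* sin t.

(* The integral of g over the unit circle against normalized Lebesgue measure. *)
Definition circle_integral (R : realType) (g : Cplx R -> Cplx R) : Cplx R :=
  let mean (u : R -> R) :=
    (pi *+ 2)^-1 * \int[lebesgue_measure]_(t in `[0, pi *+ 2]) u t in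
  mean (fun t => complex.Re (g (expi t)))
    +i* mean (fun t => complex.Im (g (expi t))).

Definition fourier_coef (R : realType) (g : Cplx R -> Cplx R) (n : int) :
    Cplx R :=
  circle_integral (fun zeta => g zeta * zeta ^ (- n)).

(* P g is read as the analytic function on the unit disk whose Taylor
   coefficients are the Fourier coefficients of g of index n >= 0. *)
Definition riesz_projection (R : realType) (g : Cplx R -> Cplx R) (z : Cplx R) :
    Cplx R :=
  limn (series (fun n : nat => fourier_coef g n%:Z * z ^+ n : Cplx R)).

Definition toeplitz (R : realType) (phi f : Cplx R -> Cplx R) :
    Cplx R -> Cplx R :=
  riesz_projection (fun zeta => phi zeta * f zeta).

Section holomorphic.
Variable R : realType.
Implicit Types (f g : Cplx R -> Cplx R).

Lemma hol_cdisk_cst (c : Cplx R) : hol_cdisk (fun=> c).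
Proof. by exists setT; split; [exact: openT| |move=> z _; exact: derivable_cst]. Qed.

Lemma hol_cdisk_lin (a : R[i]) f g :
  hol_cdisk f -> hol_cdisk g -> hol_cdisk (a *: f + g).
Proof.
move=> [U [oU DU dU]] [V [oV DV dV]]; exists (U `&` V); split.
- exact: openI.
- by move=> z Dz; split; [exact: DU|exact: DV].
- move=> z [Uz Vz]; apply: derivableD; last exact: dV.
  by apply: derivableZ; exact: dU.
Qed.

Lemma hol_cdisk_mul f g :
  hol_cdisk f -> hol_cdisk g -> hol_cdisk (fun z => f z * g z).
Proof.
move=> [U [oU DU dU]] [V [oV DV dV]]; exists (U `&` V); split.
- exact: openI.
- by move=> z Dz; split; [exact: DU|exact: DV].
- by move=> z [Uz Vz]; apply: (@derivableM _ _ f g); [exact: dU|exact: dV].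
Qed.

Lemma hol_cdisk_continuous f : hol_cdisk f ->
  forall z, closed_disk z -> {for z, continuous f}.
Proof.
move=> [U [oU DU dU]] z Dz; apply: differentiable_continuous.
by apply/derivable1_diffP; exact/dU/DU.
Qed.

Lemma hol_cdisk_inv f : hol_cdisk f -> (forall z, closed_disk z -> f z != 0) ->
  hol_cdisk (fun z => (f z)^-1).
Proof.
move=> [U [oU DU dU]] f0.
exists (U `&` [set z | f z != 0]); split.
- rewrite openE => z [Uz fz0].
  have cf : {for z, continuous f}.
    by apply: differentiable_continuous; apply/derivable1_diffP; exact: dU.
  apply: filterI; first exact: open_nbhs_nbhs.
  have : nbhs (f z) [set w : Cplx R | w != 0].
    apply: open_nbhs_nbhs; split => //.
    have -> : [set w : Cplx R | w != 0] = ~` [set 0].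
      by apply/seteqP; split=> w /= /eqP.
    by rewrite openC; exact: accessible_closed_set1 (hausdorff_accessible (@norm_hausdorff _ _)) _.
  exact: cf.
- by move=> z Dz; split; [exact: DU|exact: f0].
- by move=> z [Uz fz0]; apply: derivableV => //; exact: dU.
Qed.

Lemma hol_cdisk_id : hol_cdisk (fun z : Cplx R => z).
Proof. by exists setT; split; [exact: openT| |move=> z _; exact: derivable_id]. Qed.

Lemma hol_cdisk_affine (a b : Cplx R) : hol_cdisk (fun z : Cplx R => b + a * z).
Proof.
have := hol_cdisk_lin a hol_cdisk_id (hol_cdisk_cst b).
by congr hol_cdisk; apply/funext => z; rewrite addrC.
Qed.

Lemma blaschke_denom_neq0 (l z : Cplx R) :
  unit_disk l -> closed_disk z -> 1 - conjc l * z != 0.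
Proof.
rewrite /unit_disk /closed_disk /= => l1 z1.
rewrite subr_eq0; apply/negP => /eqP /(congr1 (fun w : Cplx R => `|w|)).
rewrite normr1 normrM => e.
have : `|conjc l| * `|z| < 1 :> R[i].
  by rewrite normcJ (le_lt_trans _ l1)// ler_piMr.
by rewrite -e ltxx.
Qed.

Lemma hol_cdisk_blaschke (lam : nat -> Cplx R)
    (hlam : forall k, (1 <= k)%N -> unit_disk (lam k)) (n : nat) :
  hol_cdisk (blaschke lam n).
Proof.
elim: n => [|n IHn].
  have -> : blaschke lam 0 = fun=> 1 by apply/funext => z; rewrite /blaschke big_nil.
  exact: hol_cdisk_cst.
have h1 : hol_cdisk (fun z => lam n.+1 - z).
  have := hol_cdisk_affine (-1) (lam n.+1).
  by congr hol_cdisk; apply/funext => z; rewrite mulN1r.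
have h2 : hol_cdisk (fun z => 1 - conjc (lam n.+1) * z).
  have := hol_cdisk_affine (- conjc (lam n.+1)) 1.
  by congr hol_cdisk; apply/funext => z; rewrite mulNr.
have h3 := hol_cdisk_inv h2 (fun z => blaschke_denom_neq0 (hlam n.+1 isT)).
have := hol_cdisk_mul IHn (hol_cdisk_mul h1 h3).
by congr hol_cdisk; apply/funext => z; rewrite /blaschke [RHS]big_nat_recr.
Qed.

Let toC (p : R * R) : Cplx R := p.1 +i* p.2.

Lemma normc_re (z : R[i]) : `|z| = (Normc.normc z)%:C.
Proof. by []. Qed.

Lemma normc_continuous : continuous (fun z : Cplx R => Normc.normc z : R).
Proof.
move=> z; apply/(@cvgrPdist_lt _ R^o _ (nbhs (z : Cplx R))) => e e0.
have e0C : 0 < e%:C by rewrite ltcR.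
have H : \forall w \near z, `|z - w| < e%:C.
  exact: (@cvgr_dist_lt _ _ _ (nbhs z) _ id z cvg_id).
apply: filterS H => w zw; rewrite -ltcR.
have -> : `|Normc.normc z - Normc.normc w|%:C = `| `|z| - `|w| | :> R[i].
  rewrite (normc_re z) (normc_re w) -(rmorphB (real_complex R)) (normc_def (_%:C)) /=.
  by rewrite expr0n addr0 sqrtr_sqr.
by rewrite (le_lt_trans (ler_dist_dist _ _)).
Qed.

Lemma toC_continuous : continuous toC.
Proof.
move=> p; apply/(@cvgrPdist_lt _ (Cplx R) _ (nbhs p)) => /= e e0.
have [e1 e1E] : exists e1 : R, e = e1%:C.
  by exists (complex.Re e); rewrite RRe_real// gtr0_real.
move: e0; rewrite e1E ltcR => e10.
have e20 : 0 < e1 / 2 by rewrite divr_gt0.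
near=> q.
have -> : toC p - toC q = (p.1 - q.1)%:C + 'i%C * (p.2 - q.2)%:C :> R[i].
  by apply/eqP; rewrite eq_complex /=; simpc.
rewrite (le_lt_trans (ler_normD _ _))// normrM.
have -> : `|'i%C : R[i]| = 1 by rewrite normc_def /= expr0n expr1n add0r sqrtr1.
have nr (r : R) : `|r%:C : R[i]| = `|r|%:C.
  by rewrite normc_def /= expr0n addr0 sqrtr_sqr.
rewrite mul1r !nr -(rmorphD (real_complex R)) ltcR.
rewrite (splitr e1) ltrD//.
  by near: q; exact: (@cvgr_dist_lt _ R^o _ (nbhs p) _ fst p.1 cvg_fst).
by near: q; exact: (@cvgr_dist_lt _ R^o _ (nbhs p) _ snd p.2 cvg_snd).
Unshelve. all: by end_near. Qed.

Lemma closed_disk_compact : compact (@closed_disk R).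
Proof.
have -> : @closed_disk R = toC @` (toC @^-1` (@closed_disk R)).
  apply/seteqP; split=> [z Dz|_ [p Dp <-]//].
  by exists (complex.Re z, complex.Im z) => /=; rewrite /toC /=; case: z Dz.
apply: continuous_compact; first exact: continuous_subspaceT toC_continuous.
have clD : closed (toC @^-1` (@closed_disk R)).
  have -> : toC @^-1` (@closed_disk R) =
      (fun p => Normc.normc (toC p)) @^-1` [set x | x <= 1].
    by apply/seteqP; split=> p; rewrite /closed_disk /= normc_re lecR.
  apply: closed_comp; last exact: closed_le.
  move=> p _; apply: continuous_comp; [exact: toC_continuous|exact: normc_continuous].
apply: (subclosed_compact clD (compact_setX (@segment_compact _ (-1) 1) (@segment_compact _ (-1) 1))).
move=> [x y]; rewrite /closed_disk /= normc_re (lecR _ 1) /= => h.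
have h1 : x ^+ 2 + y ^+ 2 <= 1.
  rewrite -(@sqr_sqrtr _ (x ^+ 2 + y ^+ 2)) ?addr_ge0 ?sqr_ge0//.
  by rewrite exprn_ile1// sqrtr_ge0.
rewrite !in_itv/= -!ler_norml; split.
  by rewrite -(@ler_pXn2r _ 2)// ?nnegrE// expr1n real_normK ?num_real// (le_trans _ h1)// lerDl sqr_ge0.
by rewrite -(@ler_pXn2r _ 2)// ?nnegrE// expr1n real_normK ?num_real// (le_trans _ h1)// lerDr sqr_ge0.
Qed.

Lemma hol_cdisk_bounded f : hol_cdisk f ->
  exists M : R, forall z, closed_disk z -> Normc.normc (f z) <= M.
Proof.
move=> hf.
have cK : compact ((fun z => Normc.normc (f z)) @` (@closed_disk R)).
  apply: continuous_compact; last exact: closed_disk_compact.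
  apply: continuous_in_subspaceT => z /set_mem Dz.
  apply: continuous_comp; [exact: hol_cdisk_continuous|exact: normc_continuous].
have [M [_ MA]] := compact_bounded cK.
exists (M + 1) => z Dz; apply: (le_trans (ler_norm _)).
by apply: (MA (M + 1)); [rewrite ltrDl|exists z].
Qed.

End holomorphic.

(* A function analytic near the closed disk is determined by its values on the
   closed disk, so Hol is modelled by functions on closed-disk points that extend
   analytically to a neighbourhood: this makes the sup norm separating. *)
Definition cdisk_pt (R : realType) := {z : Cplx R | `|z| <= 1}.

Definition hol_pred (R : realType) : {pred cdisk_pt R -> Cplx R} :=
  mem [set f | exists2 F, hol_cdisk F & forall z, f z = F (val z)].

Record Hol (R : realType) := MkHol {
  hol_fun :> cdisk_pt R -> Cplx R ;
  hol_funP : hol_fun \in @hol_pred R }.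

HB.instance Definition _ (R : realType) := [isSub for @hol_fun R].
HB.instance Definition _ (R : realType) := [Choice of Hol R by <:].

Section hol_space.
Variable R : realType.

Lemma hol_submod_closed : submod_closed (@hol_pred R : {pred cdisk_pt R -> Cplx R}).
Proof.
split; first by rewrite inE; exists (fun=> 0) => //; exact: hol_cdisk_cst.
move=> a f g; rewrite !inE => -[F hF fF] [G hG gG].
exists (a *: F + G); first exact: hol_cdisk_lin.
by move=> z; rewrite /= !fctE fF gG.
Qed.

HB.instance Definition _ :=
  GRing.isSubmodClosed.Build R[i] (cdisk_pt R -> Cplx R) (@hol_pred R)
    hol_submod_closed.
HB.instance Definition _ := [SubChoice_isSubLmodule of Hol R by <:].

Definition hol_norm (f : Hol R) : R :=
  sup [set Normc.normc (f z) | z in [set z | unit_disk (val z)]].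

Lemma hol_norm_has_sup (f : Hol R) :
  has_sup [set Normc.normc (f z) | z in [set z | unit_disk (val z)]].
Proof.
have z01 : `|0 : Cplx R| < 1 by rewrite normr0 ltr01.
split.
  by exists (Normc.normc (f (exist _ 0 (ltW z01)))), (exist _ 0 (ltW z01)).
have := hol_funP f; rewrite inE => -[F /hol_cdisk_bounded[M hM] fF].
by exists M => _ [z _ <-]; rewrite fF; apply: hM; exact: (valP z).
Qed.

Lemma hol_norm_ub (f : Hol R) z : unit_disk (val z) ->
  Normc.normc (f z) <= hol_norm f.
Proof.
move=> Dz; apply: (ub_le_sup (hol_norm_has_sup f).2).
by exists z.
Qed.

Lemma hol_norm_le (f : Hol R) (M : R) :
  (forall z, unit_disk (val z) -> Normc.normc (f z) <= M) -> hol_norm f <= M.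
Proof.
by move=> h; apply: (ge_sup (hol_norm_has_sup f).1) => _ [z Dz <-]; exact: h.
Qed.

Lemma hol_norm_ge0 (f : Hol R) : 0 <= hol_norm f.
Proof.
have [[_ [z Dz _]] _] := hol_norm_has_sup f.
by apply: le_trans (hol_norm_ub f Dz); rewrite -ler0c -normc_re normr_ge0.
Qed.

Lemma hol_normD (f g : Hol R) :
  (hol_norm (f + g))%:C <= (hol_norm f)%:C + (hol_norm g)%:C.
Proof.
rewrite -(rmorphD (real_complex R)) lecR; apply: hol_norm_le => z Dz.
have -> : (f + g) z = f z + g z by [].
rewrite (le_trans _ (lerD (hol_norm_ub f Dz) (hol_norm_ub g Dz)))//.
by rewrite -lecR rmorphD -!normc_re; exact: (@ler_normD R[i] R[i]).
Qed.

Let hol_normZ_le (a : R[i]) (f : Hol R) :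
  hol_norm (a *: f) <= Normc.normc a * hol_norm f.
Proof.
apply: hol_norm_le => z Dz.
have -> : (a *: f) z = a * f z by [].
rewrite Normc.normcM ler_wpM2l ?hol_norm_ub//.
by rewrite -ler0c -normc_re normr_ge0.
Qed.

Lemma hol_normZ (a : R[i]) (f : Hol R) :
  (hol_norm (a *: f))%:C = `|a| * (hol_norm f)%:C.
Proof.
rewrite normc_re -(rmorphM (real_complex R)); congr (_%:C).
apply/eqP; rewrite eq_le hol_normZ_le /=.
have [->|a0] := eqVneq a 0.
  by rewrite Normc.normc0 mul0r hol_norm_ge0.
have na : 0 < Normc.normc a by rewrite -ltcR -normc_re normr_gt0.
rewrite -ler_pdivlMl// -Normc.normcV.
by rewrite -[X in hol_norm X <= _](scalerK a0) hol_normZ_le.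
Qed.

Lemma hol_norm0_eq0 (f : Hol R) : (hol_norm f)%:C = 0 -> f = 0.
Proof.
move=> /complexI f0.
have := hol_funP f; rewrite inE => -[F hF fF].
have F0 (w : Cplx R) : unit_disk w -> F w = 0.
  move=> Dw; have Dw' : `|w| <= 1 := ltW Dw.
  rewrite -(fF (exist _ w Dw')); apply: Normc.eq0_normc.
  apply/eqP; rewrite eq_le -{1}f0 hol_norm_ub//=.
  by rewrite -ler0c -normc_re normr_ge0.
apply: val_inj; apply/funext => -[z Dz] /=.
rewrite fF /=; apply/eqP; apply/negPn/negP => Fz0.
have Fz : 0 < `|F z| by rewrite normr_gt0.
have [e /= e0 he] : nbhs_ball (z : Cplx R) [set t | `|F z - F t| < `|F z|].
  apply/(@nbhs_ballP _ (Cplx R)).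
  exact: (@cvgr_dist_lt _ (Cplx R) _ (nbhs z) _ F (F z)
    (hol_cdisk_continuous hF Dz) `|F z| Fz).
have e1 : exists2 d : R, 0 < d < 1 & d%:C < e.
  have eR : (complex.Re e)%:C = e by rewrite RRe_real// gtr0_real.
  have re0 : 0 < complex.Re e by rewrite -ltcR eR.
  exists (Num.min (complex.Re e / 2) (1 / 2)).
    apply/andP; split; first by rewrite lt_min !divr_gt0.
    by rewrite gt_min [X in _ || X]ltr_pdivrMr// mul1r ltr1n orbT.
  by rewrite -eR ltcR gt_min ltr_pdivrMr// ltr_pMr// ltr1n.
case: e1 => d /andP[d0 d1] de.
pose w : Cplx R := (1 - d%:C) * z.
have Dw : unit_disk w.
  rewrite /unit_disk /= normrM -(rmorphB (real_complex R) 1 d).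
  rewrite gtr0_norm ?ltcR ?subr_gt0//.
  apply: (@le_lt_trans _ _ (1 - d)%:C).
    by rewrite ler_piMr// (lecR 0) subr_ge0 ltW.
  by rewrite (ltcR _ 1) gtrBl.
have bw : ball (z : Cplx R) e w.
  rewrite -ball_normE /= /w mulrBl mul1r opprB addrC subrK normrM.
  by rewrite (le_lt_trans _ de)// gtr0_norm ?ltcR// ler_piMr// (lecR 0) ltW.
by have /= := he _ bw; rewrite (F0 _ Dw) subr0 ltxx.
Qed.

HB.instance Definition _ := @Lmodule_isNormed.Build R[i] (Hol R)
  (fun f => (hol_norm f)%:C) hol_normD hol_normZ hol_norm0_eq0.

End hol_space.

Lemma hol_of_subproof (R : realType) (F : Cplx R -> Cplx R) :
  hol_cdisk F -> (fun z : cdisk_pt R => F (val z)) \in @hol_pred R.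
Proof. by move=> hF; rewrite inE; exists F. Qed.

Definition hol_of (R : realType) (F : Cplx R -> Cplx R) (hF : hol_cdisk F) :
    Hol R :=
  MkHol (hol_of_subproof hF).

(* Main.v *)
Require Import Defs.
From mathcomp Require Import all_boot all_order all_algebra.
From mathcomp Require Import all_classical all_reals all_analysis.
From mathcomp Require Import complex.
From mathcomp Require Import ring lra.

(** Let b_k be the k-th Blaschke factor and B_n = b_1 ... b_n.

    The coefficients of an expansion f = sum a_n B_n are forced.  Let T_m f be
    the Cauchy transform of conj(B_m) f over the unit circle, evaluated at
    lambda_(m+1).  On the circle conj(B_m) = 1 / B_m.  Hence for n > m the
    function conj(B_m) B_n is b_(m+1) ... b_n, which is its own Cauchy transform
    and vanishes at lambda_(m+1); for n <= m it is the conjugate of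
    b_(n+1) ... b_m, whose Cauchy transform is the constant
    conj(lambda_(n+1) ... lambda_m).  So T_m - conj(lambda_m) T_(m-1) takes the
    value 1 on B_m and 0 on the other B_n ([blaschke_coef_blaschke]).  It is
    bounded for the sup norm on the circle, and can therefore be applied term by
    term to a uniformly convergent expansion ([blaschke_coef_unique]): this
    gives both uniqueness and the formula for the coefficients.

    For existence, f is analytic on |w| <= s for some s > 1, and by the Cauchy
    formula it is enough to expand the kernel 1 / (w - z) for |w| = s.
    Telescoping 1 - B_N(z) / B_N(w) gives an expansion in the B_n(z) whose
    remainder is B_N(z) / B_N(w) times a bounded function ([kernel_expansion]).
    For |w| = s one has |1 / b_k(w)|^2 <= 1 - c (1 - |lambda_k|) with c > 0
    depending only on s, so 1 / B_N(w) tends to 0 uniformly because the sum of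
    the 1 - |lambda_k| diverges ([expansion_exists]).

    Both parts rest on the Cauchy formula for a function that is only assumed to
    be differentiable at each point near the closed disk.  Goursat's bisection
    argument is carried out directly in the coordinates (l, t) of the homotopy
    z + l (e^it - z) that shrinks the unit circle to z ([bdry_int_eq0]); letting
    l tend to 0 gives the formula ([cauchy_formula]).

    The sup norm over the open disk agrees with uniform convergence on the closed
    disk by continuity, whence the Schauder basis ([hol_cvgP]). *)

Set Implicit Arguments.
Unset Strict Implicit.
Unset Printing Implicit Defensive.

Import Order.TTheory GRing.Theory Num.Theory.
Import numFieldNormedType.Exports.

Local Open Scope classical_set_scope.
Local Open Scope ring_scope.
Local Open Scope complex_scope.

(** * Bisection of rectangles *)
Section bisection.
Variable R : realType.
Implicit Types I J : R * R.

Definition subitv I' I := [&& I.1 <= I'.1, I'.1 < I'.2 & I'.2 <= I.2].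

Definition mid I := (I.1 + I.2) / 2.

Definition half (b : bool) I := if b then (I.1, mid I) else (mid I, I.2).

Lemma half_sub b I : I.1 < I.2 -> subitv (half b I) I.
Proof. by rewrite /subitv /half /mid; case: b => /= ?; lra. Qed.

Lemma half_len b I : (half b I).2 - (half b I).1 = (I.2 - I.1) / 2.
Proof. by rewrite /half /mid; case: b => /=; field. Qed.

Lemma subitv_trans I J K : subitv I J -> subitv J K -> subitv I K.
Proof. by rewrite /subitv => /and3P[? ? ?] /and3P[? ? ?]; apply/and3P; split; lra. Qed.

Lemma nested_itv (I_ : nat -> R * R) : (forall n, subitv (I_ n.+1) (I_ n)) ->
  exists x, forall n, (I_ n).1 <= x <= (I_ n).2.
Proof.
move=> H.
have mono n m : (n <= m)%N -> (I_ n).1 <= (I_ m).1 /\ (I_ m).2 <= (I_ n).2.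
  move=> /subnK <-; elim: (m - n)%N => [|k [IH1 IH2]]; first by rewrite add0n.
  have /and3P[? ? ?] := H (k + n)%N.
  by rewrite addSn; split; lra.
have lt n : (I_ n).1 <= (I_ n).2.
  by have /and3P[? ? ?] := H n; have /and3P[? ? ?] := H n.+1; lra.
have ub m : ubound (range (fun n => (I_ n).1)) (I_ m).2.
  move=> _ [n _ <-].
  have [nm|mn] := leqP n m.
    by have [? ?] := mono _ _ nm; have := lt m; lra.
  by have [? ?] := mono _ _ (ltnW mn); have := lt n; lra.
exists (sup (range (fun n => (I_ n).1))) => m; apply/andP; split.
  by apply: ub_le_sup; [exists (I_ 0).2; exact: ub|exists m].
by apply: ge_sup; [exists (I_ 0).1, 0%N|exact: ub].
Qed.

(** The counting argument behind Goursat's theorem.  If [N I J] were positive,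
    halving both sides repeatedly would give rectangles of diameter D / 2^n on
    which [N] is at least [N I J] / 4^n; near their common point this
    contradicts the local bound, which is of smaller order than diameter
    squared. *)
Lemma bisection_vanish (N : R * R -> R * R -> R) I J :
  I.1 < I.2 -> J.1 < J.2 ->
  (forall I' J', subitv I' I -> subitv J' J ->
     N I' J' <= N (half true I') (half true J') + N (half true I') (half false J')
       + (N (half false I') (half true J') + N (half false I') (half false J'))) ->
  (forall x y, I.1 <= x <= I.2 -> J.1 <= y <= J.2 -> forall e, 0 < e ->
     exists2 d, 0 < d & forall I' J', subitv I' I -> subitv J' J ->
       I'.1 <= x <= I'.2 -> J'.1 <= y <= J'.2 ->
       I'.2 - I'.1 < d -> J'.2 - J'.1 < d ->
       N I' J' <= e * (I'.2 - I'.1 + (J'.2 - J'.1)) ^+ 2) ->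
  N I J <= 0.
Proof.
move=> ltI ltJ sub loc.
pose ok (s : (R * R) * (R * R)) := subitv s.1 I && subitv s.2 J.
have /choice[g hg] (s : (R * R) * (R * R)) : exists ij : bool * bool,
    ok s -> N s.1 s.2 <= 4 * N (half ij.1 s.1) (half ij.2 s.2).
  have [oks|] := boolP (ok s); last by exists (true, true).
  have /andP[s1 s2] := oks.
  have h := sub _ _ s1 s2.
  apply: contrapT => /forallNP hN.
  have hlt ij : 4 * N (half ij.1 s.1) (half ij.2 s.2) < N s.1 s.2.
    by rewrite ltNge; apply/negP => ?; apply: (hN ij).
  have := hlt (true, true); have := hlt (true, false).
  have := hlt (false, true); have := hlt (false, false) => /=.
  by lra.
pose S n := iter n (fun s => (half (g s).1 s.1, half (g s).2 s.2)) (I, J).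
have SS n : S n.+1 = (half (g (S n)).1 (S n).1, half (g (S n)).2 (S n).2) by [].
have okS n : ok (S n).
  elim: n => [|n /andP[h1 h2]]; first by rewrite /ok /S /subitv /= !lexx ltI ltJ.
  rewrite /ok SS /=.
  have /and3P[_ l1 _] := h1; have /and3P[_ l2 _] := h2.
  by rewrite (subitv_trans (half_sub _ l1) h1) (subitv_trans (half_sub _ l2) h2).
have nest1 n : subitv (S n.+1).1 (S n).1.
  by have /andP[/and3P[_ l1 _] _] := okS n; exact: half_sub.
have nest2 n : subitv (S n.+1).2 (S n).2.
  by have /andP[_ /and3P[_ l1 _]] := okS n; exact: half_sub.
have [x hx] := nested_itv nest1.
have [y hy] := nested_itv nest2.
have len1 n : (S n).1.2 - (S n).1.1 = (I.2 - I.1) / 2 ^+ n.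
  elim: n => [|n IH]; first by rewrite expr0 divr1.
  by rewrite SS half_len IH exprS; field; rewrite expf_neq0.
have len2 n : (S n).2.2 - (S n).2.1 = (J.2 - J.1) / 2 ^+ n.
  elim: n => [|n IH]; first by rewrite expr0 divr1.
  by rewrite SS half_len IH exprS; field; rewrite expf_neq0.
have NS n : N I J <= 4 ^+ n * N (S n).1 (S n).2.
  elim: n => [|n IH]; first by rewrite expr0 mul1r.
  apply: (le_trans IH); rewrite exprSr -mulrA ler_pM2l ?exprn_gt0//.
  exact: hg.
set D := I.2 - I.1 + (J.2 - J.1).
have D0 : 0 < D by rewrite /D; lra.
apply/ler_addgt0Pr => e e0; rewrite add0r.
have e'0 : 0 < e / D ^+ 2 by rewrite divr_gt0// exprn_gt0.
have [d d0 hd] := loc x y (hx 0%N) (hy 0%N) _ e'0.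
have [n hn] : exists n, D / 2 ^+ n < d.
  have [n hn] : exists n : nat, D / d < n%:R.
    have := archi_boundP (ltW (divr_gt0 D0 d0)).
    by exists (Num.Def.archi_bound (D / d)).
  exists n; rewrite ltr_pdivrMr ?exprn_gt0// mulrC -ltr_pdivrMr//.
  by rewrite (lt_trans hn)// -natrX ltr_nat ltn_expl.
have p2 : 0 < 2 ^+ n :> R by rewrite exprn_gt0.
have /andP[oI oJ] := okS n.
apply: (le_trans (NS n)).
have lt1 : (S n).1.2 - (S n).1.1 < d.
  apply: le_lt_trans hn; rewrite len1 ler_pM2r ?invr_gt0//.
  by rewrite /D; lra.
have lt2 : (S n).2.2 - (S n).2.1 < d.
  apply: le_lt_trans hn; rewrite len2 ler_pM2r ?invr_gt0//.
  by rewrite /D; lra.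
have := hd _ _ oI oJ (hx n) (hy n) lt1 lt2.
rewrite len1 len2 -mulrDl -/D => h.
apply: (@le_trans _ _ (4 ^+ n * (e / D ^+ 2 * (D / 2 ^+ n) ^+ 2))).
  by rewrite ler_pM2l// exprn_gt0.
have -> : 4 ^+ n = (2 ^+ n) ^+ 2 :> R by rewrite exprAC; congr (_ ^+ _); ring.
by rewrite le_eqVlt; apply/orP; left; apply/eqP; field; rewrite !gt_eqF.
Qed.

End bisection.

(** * The real-valued modulus and continuity *)
Section complex_norm.
Variable R : realType.
Implicit Types x y z : Cplx R.
Local Notation normc := Normc.normc.

Lemma normc_ge0 z : 0 <= normc z.
Proof. by rewrite -ler0c -normc_re normr_ge0. Qed.

Lemma ler_normcD x y : normc (x + y) <= normc x + normc y.
Proof.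
by rewrite -lecR (rmorphD (real_complex R)) -!normc_re (@ler_normD R[i] R[i]).
Qed.

Lemma normcN z : normc (- z) = normc z.
Proof. by apply: complexI; rewrite -!normc_re normrN. Qed.

Lemma normc_distC x y : normc (x - y) = normc (y - x).
Proof. by rewrite -normcN opprB. Qed.

Lemma ler_normcB x y : normc x - normc y <= normc (x - y).
Proof. by have := ler_normcD (x - y) y; rewrite subrK; lra. Qed.

Lemma normc_real (r : R) : normc r%:C = `|r|.
Proof. by rewrite /= expr0n addr0 sqrtr_sqr. Qed.

Lemma normc_conj z : normc (conjc z) = normc z.
Proof. by case: z => a b /=; rewrite sqrrN. Qed.

Lemma normc_eq0 z : (normc z == 0) = (z == 0).
Proof.
apply/eqP/eqP => [|->]; [exact: Normc.eq0_normc|exact: Normc.normc0].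
Qed.

Lemma normc_gt0 z : (0 < normc z) = (z != 0).
Proof. by rewrite lt_neqAle normc_ge0 andbT eq_sym normc_eq0. Qed.

Lemma normcX z n : normc (z ^+ n) = normc z ^+ n.
Proof.
by elim: n => [|n IH]; rewrite ?expr0 ?Normc.normc1// !exprS Normc.normcM IH.
Qed.

Lemma Re_le_normc z : `|complex.Re z| <= normc z.
Proof. by rewrite -lecR -normc_re; exact: normc_ge_Re. Qed.

Lemma Im_le_normc z : `|complex.Im z| <= normc z.
Proof. by case: z => a b /=; rewrite -sqrtr_sqr ler_wsqrtr// lerDr sqr_ge0. Qed.

Lemma normc_le_ReIm (a b : R) : normc (a +i* b) <= `|a| + `|b|.
Proof.
have -> : a +i* b = a%:C + 'i%C * b%:C by apply/eqP; rewrite eq_complex /=; simpc.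
apply: (le_trans (ler_normcD _ _)); rewrite Normc.normcM !normc_real.
by rewrite [normc 'i%C]/= expr0n expr1n add0r sqrtr1 mul1r.
Qed.

Lemma normc1_conjV z : normc z = 1 -> conjc z = z^-1.
Proof.
move=> z1; have z0 : z != 0 by rewrite -normc_eq0 z1 oner_eq0.
apply: (mulfI z0); rewrite divff// -sqr_normc (normc_re z) z1.
by rewrite expr1n.
Qed.

Lemma cplx_cvgP (T : Type) (F : set_system T) (FF : Filter F)
    (g : T -> Cplx R) (l : Cplx R) :
  g @ F --> l <->
  forall e : R, 0 < e -> \forall t \near F, normc (l - g t) < e.
Proof.
split=> [gl e e0|H].
  have e0C : 0 < e%:C by rewrite ltcR.
  have := @cvgr_dist_lt _ (Cplx R) _ F FF g l gl _ e0C.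
  by apply: filterS => t; rewrite normc_re ltcR.
apply/(@cvgrPdist_lt _ (Cplx R) _ F FF) => e e0.
have eR : (complex.Re e)%:C = e by rewrite RRe_real// gtr0_real.
have re0 : 0 < complex.Re e by rewrite -ltcR eR.
by apply: filterS (H _ re0) => t; rewrite normc_re -eR ltcR.
Qed.

Lemma cplx_continuousP (T : topologicalType) (g : T -> Cplx R) (t : T) :
  {for t, continuous g} <->
  forall e : R, 0 < e -> \forall s \near t, normc (g t - g s) < e.
Proof. exact: (@cplx_cvgP _ (nbhs t)). Qed.

End complex_norm.

Section circle_param.
Variable R : realType.
Local Notation normc := Normc.normc.

Lemma normc_expi (t : R) : normc (expi t) = 1.
Proof. by rewrite /= cos2Dsin2 sqrtr1. Qed.

Lemma expi_neq0 (t : R) : expi t != 0.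
Proof. by rewrite -normc_eq0 normc_expi oner_eq0. Qed.

Lemma continuous_ReIm (T : topologicalType) (u v : T -> R) (t : T) :
  {for t, continuous u} -> {for t, continuous v} ->
  {for t, continuous (fun t => (u t +i* v t : Cplx R))}.
Proof.
move=> cu cv; apply/cplx_continuousP => e e0.
have e20 : 0 < e / 2 by rewrite divr_gt0.
near=> s.
have -> : (u t +i* v t : Cplx R) - (u s +i* v s) = (u t - u s) +i* (v t - v s) by [].
apply: (le_lt_trans (normc_le_ReIm _ _)); rewrite [ltRHS]splitr ltrD//.
  by near: s; exact: (@cvgr_dist_lt _ R^o _ (nbhs t) _ u (u t) cu).
by near: s; exact: (@cvgr_dist_lt _ R^o _ (nbhs t) _ v (v t) cv).
Unshelve. all: by end_near. Qed.

Lemma continuous_Re (T : topologicalType) (g : T -> Cplx R) (t : T) :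
  {for t, continuous g} -> {for t, continuous (fun t => complex.Re (g t))}.
Proof.
move=> /cplx_continuousP H; apply/(@cvgrPdist_lt _ R^o _ (nbhs t)) => e /H.
apply: filterS => s; apply: le_lt_trans.
have -> : complex.Re (g t) - complex.Re (g s) = complex.Re (g t - g s).
  by case: (g t) => ? ?; case: (g s).
exact: Re_le_normc.
Qed.

Lemma continuous_Im (T : topologicalType) (g : T -> Cplx R) (t : T) :
  {for t, continuous g} -> {for t, continuous (fun t => complex.Im (g t))}.
Proof.
move=> /cplx_continuousP H; apply/(@cvgrPdist_lt _ R^o _ (nbhs t)) => e /H.
apply: filterS => s; apply: le_lt_trans.
have -> : complex.Im (g t) - complex.Im (g s) = complex.Im (g t - g s).
  by case: (g t) => ? ?; case: (g s).
exact: Im_le_normc.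
Qed.

Lemma continuous_conjc (T : topologicalType) (g : T -> Cplx R) (t : T) :
  {for t, continuous g} -> {for t, continuous (fun t => conjc (g t) : Cplx R)}.
Proof.
move=> /cplx_continuousP H; apply/cplx_continuousP => e /H.
by apply: filterS => s; rewrite -rmorphB normc_conj.
Qed.

Lemma continuous_expi : continuous (@expi R).
Proof.
by move=> t; apply: continuous_ReIm; [exact: continuous_cos|exact: continuous_sin].
Qed.

Lemma continuous_realC : continuous (fun t : R => t%:C : Cplx R).
Proof.
by move=> t; apply: (@continuous_ReIm R id (fun=> 0)); [exact: cvg_id|exact: cvg_cst].
Qed.

End circle_param.

(** * Complex-valued integrals over a segment *)
Section complex_integral.
Variable R : realType.
Implicit Types (a b c : R) (g h : R -> Cplx R).
Local Notation normc := Normc.normc.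
Local Notation mu := (@lebesgue_measure R).

Definition cint a b g : Cplx R :=
  (\int[mu]_(t in `[a, b]) complex.Re (g t)) +i*
  (\int[mu]_(t in `[a, b]) complex.Im (g t)).

Lemma cintE a b g : cint a b g =
  (\int[mu]_(t in `[a, b]) complex.Re (g t)) +i*
  (\int[mu]_(t in `[a, b]) complex.Im (g t)).
Proof. by []. Qed.

Definition itv_cont a b g := forall t, a <= t <= b -> {for t, continuous g}.

Lemma itv_contW a b a' b' g : a <= a' -> b' <= b -> itv_cont a b g -> itv_cont a' b' g.
Proof. by move=> aa bb cg t ht; apply: cg; lra. Qed.

Lemma itv_contD a b g h : itv_cont a b g -> itv_cont a b h -> itv_cont a b (fun t => g t + h t).
Proof. by move=> cg ch t ht; apply: (@cvgD _ (Cplx R)); [exact: cg|exact: ch]. Qed.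

Lemma itv_contM a b g h : itv_cont a b g -> itv_cont a b h -> itv_cont a b (fun t => g t * h t).
Proof. by move=> cg ch t ht; apply: (@cvgM (Cplx R)); [exact: cg|exact: ch]. Qed.

Lemma itv_cont_cst a b (z : Cplx R) : itv_cont a b (fun=> z).
Proof. by move=> t ht; exact: cvg_cst. Qed.

Lemma itv_contV a b g : itv_cont a b g -> (forall t, a <= t <= b -> g t != 0) ->
  itv_cont a b (fun t => (g t)^-1).
Proof. by move=> cg g0 t ht; apply: (@cvgV (Cplx R)); [exact: g0|exact: cg]. Qed.

Lemma itv_cont_expi a b : itv_cont a b (@expi R).
Proof. by move=> t _; exact: continuous_expi. Qed.

Lemma itv_cont_integrable a b (u : R -> R) :
  (forall t, a <= t <= b -> {for t, continuous u}) ->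
  mu.-integrable `[a, b] (EFin \o u).
Proof.
move=> cu; apply: continuous_compact_integrable; first exact: segment_compact.
by apply: continuous_in_subspaceT => t /set_mem /=; rewrite in_itv; exact: cu.
Qed.

Lemma itv_cont_integrable_Re a b g : itv_cont a b g ->
  mu.-integrable `[a, b] (EFin \o (fun t => complex.Re (g t))).
Proof. by move=> cg; apply: itv_cont_integrable => t ht; apply: continuous_Re; exact: cg. Qed.

Lemma itv_cont_integrable_Im a b g : itv_cont a b g ->
  mu.-integrable `[a, b] (EFin \o (fun t => complex.Im (g t))).
Proof. by move=> cg; apply: itv_cont_integrable => t ht; apply: continuous_Im; exact: cg. Qed.

Lemma eq_cint a b g h : (forall t, a <= t <= b -> g t = h t) ->
  cint a b g = cint a b h.
Proof.
move=> gh; rewrite /cint; congr (_ +i* _); apply: eq_Rintegral => t /set_mem /=;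
by rewrite in_itv /= => /gh ->.
Qed.

Lemma cint_split a c b g : a < c -> c < b -> itv_cont a b g ->
  cint a b g = cint a c g + cint c b g.
Proof.
move=> ac cb cg.
have cg2 : itv_cont c b g by apply: itv_contW cg => //; lra.
have E (u : R -> R) : mu.-integrable `[a, b] (EFin \o u) ->
    mu.-integrable `[c, b] (EFin \o u) ->
    \int[mu]_(t in `[a, b]) u t =
    \int[mu]_(t in `[a, c]) u t + \int[mu]_(t in `[c, b]) u t.
  move=> iu iu2; apply/eqP; rewrite addrC -subr_eq; apply/eqP.
  rewrite Rintegral_itvB//; last 2 first.
  - by rewrite bnd_simp ltW.
  - by rewrite bnd_simp ltW.
  apply: Rintegral_itv_obnd_cbnd.
  apply: integrableS iu2 => //.
  by apply: subset_itvr; rewrite bnd_simp.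
rewrite /cint (E _ (itv_cont_integrable_Re cg) (itv_cont_integrable_Re cg2)).
by rewrite (E _ (itv_cont_integrable_Im cg) (itv_cont_integrable_Im cg2)).
Qed.

Lemma cintD a b g h : itv_cont a b g -> itv_cont a b h ->
  cint a b (fun t => g t + h t) = cint a b g + cint a b h.
Proof.
move=> cg ch; rewrite /cint.
have -> : (\int[mu]_(t in `[a, b]) complex.Re (g t) +i*
           \int[mu]_(t in `[a, b]) complex.Im (g t)) +
          (\int[mu]_(t in `[a, b]) complex.Re (h t) +i*
           \int[mu]_(t in `[a, b]) complex.Im (h t)) =
  (\int[mu]_(t in `[a, b]) complex.Re (g t) + \int[mu]_(t in `[a, b]) complex.Re (h t))
  +i* (\int[mu]_(t in `[a, b]) complex.Im (g t) + \int[mu]_(t in `[a, b]) complex.Im (h t))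
  by [].
rewrite -!RintegralD//; do ?[exact: itv_cont_integrable_Re|exact: itv_cont_integrable_Im].
by congr (_ +i* _); apply: eq_Rintegral => t _; case: (g t) (h t) => ? ? [].
Qed.

Lemma cintZ a b (z : Cplx R) g : itv_cont a b g ->
  cint a b (fun t => z * g t) = z * cint a b g.
Proof.
move=> cg; rewrite /cint.
have iR := itv_cont_integrable_Re cg; have iI := itv_cont_integrable_Im cg.
case: z => x y.
have -> (u v : R) : (x +i* y) * (u +i* v) = (x * u - y * v) +i* (x * v + y * u) by [].
have iZ (r : R) (u : R -> R) : mu.-integrable `[a, b] (EFin \o u) ->
    mu.-integrable `[a, b] (EFin \o (fun t => r * u t)).
  move=> iu; have h := fun mD => @integrableZl _ _ _ _ _ mD r _ iu.
  by apply: eq_integrable (h _) => // t _; rewrite /= EFinM.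
rewrite -!RintegralZl// -RintegralB//; do ?exact: iZ.
rewrite -RintegralD//; do ?exact: iZ.
by congr (_ +i* _); apply: eq_Rintegral => t _; case: (g t).
Qed.

Lemma cintB a b g h : itv_cont a b g -> itv_cont a b h ->
  cint a b (fun t => g t - h t) = cint a b g - cint a b h.
Proof.
move=> cg ch; have -> : - cint a b h = -1 * cint a b h by rewrite mulN1r.
have cNh : itv_cont a b (fun t => -1 * h t) by apply: itv_contM ch; exact: itv_cont_cst.
rewrite -(cintZ _ ch) -(cintD cg cNh).
by apply: eq_cint => t _; rewrite mulN1r.
Qed.

Lemma cint_conj a b g : itv_cont a b g ->
  cint a b (fun t => conjc (g t)) = conjc (cint a b g).
Proof.
move=> cg; rewrite /cint /=; congr (_ +i* _).
  by apply: eq_Rintegral => t _; case: (g t).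
rewrite -[RHS]mulN1r -RintegralZl//; last exact: itv_cont_integrable_Im.
by apply: eq_Rintegral => t _; rewrite mulN1r; case: (g t).
Qed.

Lemma lebesgue_itv a b : a < b -> fine (mu `[a, b]) = b - a.
Proof. by move=> ab; rewrite lebesgue_measure_itv /= lte_fin ab. Qed.

Lemma cint_cst a b (z : Cplx R) : a < b -> cint a b (fun=> z) = (b - a)%:C * z.
Proof.
move=> ab; rewrite /cint !Rintegral_cst//= lebesgue_itv//.
by case: z => x y; apply/eqP; rewrite eq_complex /=; simpc; rewrite !(mulrC (b - a)) !eqxx.
Qed.

(** Bounding the real and imaginary parts separately costs a factor 2, which is
    harmless everywhere below. *)
Lemma cint_bound a b g (M : R) : a < b -> itv_cont a b g ->
  (forall t, a <= t <= b -> normc (g t) <= M) ->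
  normc (cint a b g) <= 2 * M * (b - a).
Proof.
move=> ab cg gM; rewrite /cint.
have E (u : R -> R) : mu.-integrable `[a, b] (EFin \o u) ->
    (forall t, a <= t <= b -> `|u t| <= M) ->
    `|\int[mu]_(t in `[a, b]) u t| <= M * (b - a).
  move=> iu uM; apply: (le_trans (le_normr_Rintegral _ _)) => //.
  rewrite -(lebesgue_itv ab) -Rintegral_cst//.
  apply: le_Rintegral.
  - by [].
  - exact: integrable_norm iu.
  - by apply: itv_cont_integrable => t _; exact: cvg_cst.
  - by move=> t /=; rewrite in_itv /=; exact: uM.
apply: (le_trans (normc_le_ReIm _ _)).
rewrite -mulrA mulr_natl mulr2n lerD//; apply: E.
- exact: itv_cont_integrable_Re.
- by move=> t /gM; apply: le_trans; exact: Re_le_normc.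
- exact: itv_cont_integrable_Im.
- by move=> t /gM; apply: le_trans; exact: Im_le_normc.
Qed.

Lemma FTC_real (F f : R -> R) a b : a < b -> continuous f ->
  (forall x : R, is_derive x 1 F (f x)) ->
  \int[mu]_(t in `[a, b]) f t = F b - F a.
Proof.
move=> ab cf dF.
have cF : continuous F.
  by move=> x; apply: differentiable_continuous; apply/derivable1_diffP; case: (dF x).
rewrite /Rintegral (@continuous_FTC2 _ f F)//.
- by apply: continuous_in_subspaceT => t _; exact: cf.
- split; first by move=> x _; case: (dF x).
  + by apply: cvg_at_right_filter; exact: cF.
  + by apply: cvg_at_left_filter; exact: cF.
- by move=> x _; rewrite derive1E; case: (dF x).
Qed.

Lemma cint_expi a b : a < b -> 'i%C * cint a b (@expi R) = expi b - expi a.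
Proof.
move=> ab; rewrite /cint /expi /=.
rewrite (@FTC_real (@sin R) (@cos R))//; last exact: continuous_cos.
have dN (x : R) : is_derive x 1 (fun x : R => - cos x) (sin x).
  by rewrite -[sin x]opprK; apply: is_deriveN.
rewrite (FTC_real ab (@continuous_sin R) dN).
by apply/eqP; rewrite eq_complex /=; apply/andP; split; apply/eqP; ring.
Qed.

(** The bound is immediate from writing the increment of [expi] as the integral
    of its derivative. *)
Lemma expi_lipschitz a b : a < b -> normc (expi b - expi a) <= 2 * (b - a).
Proof.
move=> ab; rewrite -cint_expi// Normc.normcM.
have -> : normc ('i%C : R[i]) = 1 by rewrite /= expr0n expr1n add0r sqrtr1.
rewrite mul1r -[X in X * _]mulr1; apply: cint_bound => //; first exact: itv_cont_expi.
by move=> t _; rewrite normc_expi.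
Qed.

End complex_integral.

(* Proof search on goals about integrals would otherwise unfold them down to
   Lebesgue integrals. *)
Opaque cint.

(** * Goursat's theorem for circles shrinking to a point *)
Section derivative_eps.
Variable R : realType.
Local Notation normc := Normc.normc.

Lemma near_normc (w : Cplx R) (P : Cplx R -> Prop) :
  (\forall v \near w, P v) <->
  exists2 d : R, 0 < d & forall v, normc (v - w) < d -> P v.
Proof.
split.
  move=> /(@nbhs_ballP _ (Cplx R)) [e /= e0 he].
  have eR : (complex.Re e)%:C = e by rewrite RRe_real// gtr0_real.
  exists (complex.Re e); first by rewrite -ltcR eR.
  move=> v hv; apply: he; rewrite -ball_normE /=.
  by rewrite normc_re normc_distC -eR ltcR.
move=> [d d0 hd]; apply/(@nbhs_ballP _ (Cplx R)); exists d%:C => /=.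
  by rewrite ltcR.
move=> v; rewrite -ball_normE /= normc_re ltcR normc_distC; exact: hd.
Qed.

Lemma derivable_eps (f : Cplx R -> Cplx R) (w : Cplx R) : derivable f w 1 ->
  exists D : Cplx R, forall e : R, 0 < e -> exists2 d : R, 0 < d &
    forall v, normc (v - w) < d ->
      normc (f v - f w - D * (v - w)) <= e * normc (v - w).
Proof.
move=> df; exists ('D_1 f w) => e e0.
have /(@cplx_cvgP _ _ 0^' _) /(_ _ e0) H := df.
have /near_normc[d d0 hd] : \forall h \near (0 : Cplx R), h != 0 ->
  normc ('D_1 f w - h^-1 *: ((f \o shift w) (h *: 1) - f w)) < e.
  exact: H.
exists d => // v hv.
have [->|vw] := eqVneq v w; first by rewrite !subrr mulr0 subrr Normc.normc0 mulr0.
have h0 : v - w != 0 by rewrite subr_eq0.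
have := hd (v - w); rewrite subr0 => /(_ hv h0).
have -> : (f \o shift w) ((v - w) *: 1) = f v.
  by rewrite /= /shift /= [(v - w) *: _]mulr1 subrK.
move=> /ltW h.
have -> : f v - f w - 'D_1 f w * (v - w) =
    - (('D_1 f w - (v - w)^-1 * (f v - f w)) * (v - w)).
  by rewrite mulrBl mulrAC mulVf// mul1r opprB.
by rewrite normcN Normc.normcM ler_wpM2r ?normc_ge0.
Qed.

End derivative_eps.

Section goursat.
Variable R : realType.
Variables (z : Cplx R) (z1 : Normc.normc z < 1).
Local Notation normc := Normc.normc.
Local Notation C := (Cplx R).
Implicit Types (h : C -> C) (I J : R * R).

(** At parameter [l] this is the unit circle contracted towards [z]: the unit
    circle itself for [l = 1], the point [z] for [l = 0]. *)
Definition shrunk (l t : R) : C := z + l%:C * (expi t - z).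

Definition cauchy_kernel (t : R) : C := expi t / (expi t - z).

(** The integral of the form h(w) dw / (i (w - z)) along the image of the
    boundary of [I * J] under [shrunk].  With w = z + l (e^it - z), the form
    is h(w) e^it / (e^it - z) dt along arcs and h(w) / (i l) dl along radii; the
    orientation and 1 / i = - i account for the sign of the second term. *)
Definition bdry_int h I J : C :=
  (cint J.1 J.2 (fun t => h (shrunk I.2 t) * cauchy_kernel t)
   - cint J.1 J.2 (fun t => h (shrunk I.1 t) * cauchy_kernel t))
  + 'i%C * (cint I.1 I.2 (fun l => h (shrunk l J.2) * (l%:C)^-1)
   - cint I.1 I.2 (fun l => h (shrunk l J.1) * (l%:C)^-1)).

Let cdcont h := forall w : C, normc w <= 1 -> {for w, continuous h}.

Let z1' : 0 < 1 - normc z.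
Proof. by rewrite subr_gt0. Qed.

Lemma expi_sub_ge t : 1 - normc z <= normc (expi t - z).
Proof. by rewrite -(normc_expi t); exact: ler_normcB. Qed.

Lemma expi_sub_neq0 t : expi t - z != 0.
Proof. by rewrite -normc_gt0 (lt_le_trans z1' (expi_sub_ge t)). Qed.

Lemma cauchy_kernel_le t : normc (cauchy_kernel t) <= (1 - normc z)^-1.
Proof.
rewrite /cauchy_kernel Normc.normcM Normc.normcV normc_expi mul1r.
by rewrite lef_pV2 ?posrE ?expi_sub_ge// ?normc_gt0 ?expi_sub_neq0// subr_gt0.
Qed.

Lemma shrunk_disk l t : 0 <= l -> l <= 1 -> normc (shrunk l t) <= 1.
Proof.
move=> l0 l1.
have -> : shrunk l t = (1 - l)%:C * z + l%:C * expi t.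
  by rewrite /shrunk rmorphB rmorph1 /=; ring.
apply: (le_trans (ler_normcD _ _)); rewrite !Normc.normcM !normc_real normc_expi.
rewrite !ger0_norm ?subr_ge0//.
have : (1 - l) * normc z <= (1 - l) * 1 by rewrite ler_wpM2l// ?subr_ge0// ltW.
lra.
Qed.

Lemma shrunk_cont l : continuous (shrunk l).
Proof.
move=> t; apply: (@cvgD _ C); first exact: cvg_cst.
apply: (@cvgM C); first exact: cvg_cst.
apply: (@cvgB _ C); [exact: continuous_expi|exact: cvg_cst].
Qed.

Lemma shrunk_cont_radius t : continuous (shrunk ^~ t).
Proof.
move=> l; apply: (@cvgD _ C); first exact: cvg_cst.
by apply: (@cvgM C); [exact: continuous_realC|exact: cvg_cst].
Qed.

Lemma itv_cont_cauchy_kernel a b : itv_cont a b cauchy_kernel.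
Proof.
apply: itv_contM; first exact: itv_cont_expi.
apply: itv_contV => [|t _]; last exact: expi_sub_neq0.
by apply: itv_contD; [exact: itv_cont_expi|exact: itv_cont_cst].
Qed.

Lemma itv_cont_radialV a b : 0 < a -> itv_cont a b (fun l : R => (l%:C)^-1 : C).
Proof.
move=> a0; apply: itv_contV => [l _|l al]; first exact: continuous_realC.
by rewrite -normc_eq0 normc_real normr_eq0 gt_eqF//; lra.
Qed.

Lemma itv_cont_arc h l a b : cdcont h -> 0 <= l -> l <= 1 ->
  itv_cont a b (fun t => h (shrunk l t) * cauchy_kernel t).
Proof.
move=> ch l0 l1; apply: itv_contM; last exact: itv_cont_cauchy_kernel.
move=> t _; apply: (@continuous_comp _ _ _ (shrunk l) h); first exact: shrunk_cont.
by apply: ch; exact: shrunk_disk.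
Qed.

Lemma itv_cont_radial h t a b : cdcont h -> 0 < a -> b <= 1 ->
  itv_cont a b (fun l => h (shrunk l t) * (l%:C)^-1).
Proof.
move=> ch a0 b1; apply: itv_contM; last exact: itv_cont_radialV.
move=> l al; apply: (@continuous_comp _ _ _ (shrunk ^~ t) h); first exact: shrunk_cont_radius.
by apply: ch; apply: shrunk_disk; lra.
Qed.

Lemma bdry_int_split h I J (m n : R) : cdcont h -> 0 < I.1 -> I.2 <= 1 ->
  I.1 < m < I.2 -> J.1 < n < J.2 ->
  bdry_int h I J = bdry_int h (I.1, m) (J.1, n) + bdry_int h (I.1, m) (n, J.2)
    + (bdry_int h (m, I.2) (J.1, n) + bdry_int h (m, I.2) (n, J.2)).
Proof.
case: I J => [a b] [c d] /= ch a0 b1 /andP[am mb] /andP[cn nd].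
rewrite /bdry_int /=.
have arc l : 0 <= l -> l <= 1 -> itv_cont c d (fun t => h (shrunk l t) * cauchy_kernel t).
  by move=> l0 l1; exact: itv_cont_arc.
rewrite (cint_split cn nd (arc b _ _)) ?(cint_split cn nd (arc a _ _)); [|lra..].
rewrite (cint_split am mb (itv_cont_radial (t := _) ch a0 b1)).
rewrite (cint_split am mb (itv_cont_radial (t := _) ch a0 b1)).
by do ?[move: (cint _ _ _) => ?]; ring.
Qed.

Lemma bdry_intB h g I J : cdcont h -> cdcont g -> 0 < I.1 -> I.1 < I.2 -> I.2 <= 1 ->
  bdry_int (fun w => h w - g w) I J = bdry_int h I J - bdry_int g I J.
Proof.
case: I J => [a b] [c d] /= ch cg a0 ab b1.
have arcB l : 0 <= l -> l <= 1 ->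
    cint c d (fun t => (h (shrunk l t) - g (shrunk l t)) * cauchy_kernel t) =
    cint c d (fun t => h (shrunk l t) * cauchy_kernel t) -
    cint c d (fun t => g (shrunk l t) * cauchy_kernel t).
  move=> l0 l1; rewrite -cintB; [|exact: itv_cont_arc..].
  by apply: eq_cint => t _; rewrite mulrBl.
have radB t :
    cint a b (fun l => (h (shrunk l t) - g (shrunk l t)) * (l%:C)^-1) =
    cint a b (fun l => h (shrunk l t) * (l%:C)^-1) -
    cint a b (fun l => g (shrunk l t) * (l%:C)^-1).
  rewrite -cintB; [|exact: itv_cont_radial..].
  by apply: eq_cint => l _; rewrite mulrBl.
rewrite /bdry_int /= !arcB ?radB; [|lra..].
by do ?[move: (cint _ _ _) => ?]; ring.
Qed.

(** The Cauchy kernel contributes nothing for constant [h], because the two arcs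
    and the two radii then have equal integrals; for [h w = w - z] the form is
    dw / i, whose integral is explicit. *)
Lemma bdry_int_affine (A B : C) I J : 0 < I.1 -> I.1 < I.2 -> J.1 < J.2 ->
  bdry_int (fun w => A + B * (w - z)) I J = 0.
Proof.
case: I J => [a b] [c d] /= a0 ab cd.
have arcE l : cint c d (fun t => (A + B * (shrunk l t - z)) * cauchy_kernel t) =
    A * cint c d cauchy_kernel + B * l%:C * cint c d (@expi R).
  rewrite -!cintZ; [|exact: itv_cont_expi|exact: itv_cont_cauchy_kernel].
  rewrite -cintD; last 2 first.
  - by apply: itv_contM; [exact: itv_cont_cst|exact: itv_cont_cauchy_kernel].
  - by apply: itv_contM; [exact: itv_cont_cst|exact: itv_cont_expi].
  apply: eq_cint => t _; rewrite /cauchy_kernel /shrunk.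
  by have := expi_sub_neq0 t => h; field.
have radE t : cint a b (fun l => (A + B * (shrunk l t - z)) * (l%:C)^-1) =
    A * cint a b (fun l => (l%:C)^-1) + (b - a)%:C * (B * (expi t - z)).
  rewrite -cintZ; last exact: itv_cont_radialV.
  rewrite -cint_cst// -cintD; last 2 first.
  - by apply: itv_contM; [exact: itv_cont_cst|exact: itv_cont_radialV].
  - exact: itv_cont_cst.
  apply: eq_cint => l al; rewrite /shrunk.
  have l0 : l%:C != 0 :> C by rewrite -normc_eq0 normc_real normr_eq0 gt_eqF//; lra.
  by field.
rewrite /bdry_int /= !arcE !radE.
have -> : A * cint c d cauchy_kernel + B * b%:C * cint c d (expi (R:=R)) -
   (A * cint c d cauchy_kernel + B * a%:C * cint c d (expi (R:=R))) =
   (b - a)%:C * B * cint c d (expi (R:=R)) by rewrite rmorphB /=; ring.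
have -> (X : C) : X + (b - a)%:C * (B * (expi d - z)) - (X + (b - a)%:C * (B * (expi c - z)))
  = (b - a)%:C * B * (expi d - expi c) by ring.
have i2 : 'i%C * 'i%C = -1 :> R[i] by rewrite -expr2 sqr_i.
rewrite -cint_expi//.
set X := cint _ _ _; set Y := _%:C.
have -> : Y * B * X + 'i%C * (Y * B * ('i%C * X)) = (1 + 'i%C * 'i%C) * (Y * B * X) by ring.
by rewrite i2 subrr mul0r.
Qed.

Lemma bdry_int_bound h I J (M : R) : cdcont h -> 0 < I.1 -> I.1 < I.2 -> I.2 <= 1 ->
  J.1 < J.2 ->
  (forall l t, I.1 <= l <= I.2 -> J.1 <= t <= J.2 -> normc (h (shrunk l t)) <= M) ->
  normc (bdry_int h I J) <=
    4 * M * ((1 - normc z)^-1 * (J.2 - J.1) + I.1^-1 * (I.2 - I.1)).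
Proof.
rewrite /bdry_int; move: I.1 I.2 J.1 J.2 => a b c d ch a0 ab b1 cd hM.
have M0 : 0 <= M.
  by apply: le_trans (hM a c _ _); rewrite ?normc_ge0// lexx ltW.
have arc l : a <= l <= b ->
    normc (cint c d (fun t => h (shrunk l t) * cauchy_kernel t)) <=
    2 * (M * (1 - normc z)^-1) * (d - c).
  move=> hl; apply: cint_bound => //; first by apply: itv_cont_arc => //; lra.
  move=> t ht; rewrite Normc.normcM ler_pM ?normc_ge0 ?cauchy_kernel_le//.
  exact: hM.
have rad t : c <= t <= d ->
    normc (cint a b (fun l => h (shrunk l t) * (l%:C)^-1)) <=
    2 * (M * a^-1) * (b - a).
  move=> ht; apply: cint_bound => //; first by apply: itv_cont_radial => //; lra.
  move=> l hl; rewrite Normc.normcM ler_pM ?normc_ge0//; first exact: hM.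
  rewrite Normc.normcV normc_real ger0_norm; last by lra.
  by rewrite lef_pV2 ?posrE//; lra.
apply: (le_trans (ler_normcD _ _)).
have -> : 4 * M * ((1 - normc z)^-1 * (d - c) + a^-1 * (b - a)) =
  (2 * (M * (1 - normc z)^-1) * (d - c) + 2 * (M * (1 - normc z)^-1) * (d - c)) +
  (2 * (M * a^-1) * (b - a) + 2 * (M * a^-1) * (b - a)) by ring.
have ha : a <= a <= b by lra.
have hb : a <= b <= b by lra.
have hc : c <= c <= d by lra.
have hd : c <= d <= d by lra.
apply: lerD.
  apply: (le_trans (ler_normcD _ _)); rewrite normcN.
  by apply: lerD; exact: arc.
rewrite Normc.normcM.
have -> : normc ('i%C : R[i]) = 1 by rewrite /= expr0n expr1n add0r sqrtr1.
rewrite mul1r; apply: (le_trans (ler_normcD _ _)); rewrite normcN.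
by apply: lerD; exact: rad.
Qed.

Lemma shrunk_dist l t x y : 0 <= x -> x <= 1 ->
  normc (shrunk l t - shrunk x y) <= 2 * (`|l - x| + `|t - y|).
Proof.
move=> x0 x1.
have -> : shrunk l t - shrunk x y = (l - x)%:C * (expi t - z) + x%:C * (expi t - expi y).
  by rewrite /shrunk rmorphB /=; ring.
apply: (le_trans (ler_normcD _ _)); rewrite !Normc.normcM !normc_real mulrDr.
apply: lerD.
  rewrite mulrC ler_wpM2r//; apply: (le_trans (ler_normcD _ _)).
  by rewrite normcN normc_expi; have := z1'; lra.
rewrite (ger0_norm x0) -[leRHS]mul1r ler_pM ?normc_ge0//.
have [ty|yt|->] := ltgtP t y.
- by rewrite normc_distC distrC gtr0_norm ?subr_gt0//; exact: expi_lipschitz.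
- by rewrite gtr0_norm ?subr_gt0//; exact: expi_lipschitz.
- by rewrite !subrr Normc.normc0 normr0 mulr0.
Qed.

Variables (f : C -> C).
Hypothesis df : forall w : C, normc w <= 1 -> derivable f w 1.

Let cf : cdcont f.
Proof.
move=> w w1; apply: differentiable_continuous.
by apply/derivable1_diffP; exact: df.
Qed.

(** Goursat: near a point of the rectangle, [f] is an affine function up to
    o(|w - w0|).  The affine part has zero boundary integral, so the boundary
    integral is o(diameter squared), and bisection applies. *)
Lemma bdry_int_eq0 I J : 0 < I.1 -> I.1 < I.2 -> I.2 <= 1 -> J.1 < J.2 ->
  bdry_int f I J = 0.
Proof.
move=> a0 ab b1 cd; apply: Normc.eq0_normc; apply/eqP; rewrite eq_le normc_ge0 andbT.
apply: (@bisection_vanish _ (fun I J => normc (bdry_int f I J))) => //.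
  move=> I' J' /and3P[h1 h2 h3] /and3P[h4 h5 h6].
  have mI : I'.1 < mid I' < I'.2 by rewrite /mid; lra.
  have mJ : J'.1 < mid J' < J'.2 by rewrite /mid; lra.
  rewrite (bdry_int_split cf (lt_le_trans a0 h1) (le_trans h3 b1) mI mJ).
  by do 3![apply: (le_trans (ler_normcD _ _)); rewrite ?lerD//].
move=> x y hx hy e e0.
set w0 := shrunk x y.
have w01 : normc w0 <= 1 by apply: shrunk_disk; lra.
have [D hD] := derivable_eps (df w01).
set K := (1 - normc z)^-1 + I.1^-1.
have z0 : 0 < (1 - normc z)^-1 by rewrite invr_gt0.
have a0V : 0 < I.1^-1 by rewrite invr_gt0.
have K0 : 0 < K by rewrite addr_gt0.
have e'0 : 0 < e / (8 * K) by rewrite divr_gt0// mulr_gt0.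
have [d d0 hd] := hD _ e'0.
(* By [shrunk_dist], the image under [shrunk] of a rectangle with both sides
   below d / 4 has diameter less than d. *)
exists (d / 4); first by rewrite divr_gt0.
move=> I' J' /and3P[h1 h2 h3] /and3P[h4 h5 h6] hx' hy' lI lJ.
set L := I'.2 - I'.1 + (J'.2 - J'.1).
pose g w := (f w0 - D * (w0 - z)) + D * (w - z).
have cg : cdcont g.
  move=> w _; apply: (@cvgD _ C _ (nbhs w)); first exact: cvg_cst.
  apply: (@cvgM C _ (nbhs w)); first exact: cvg_cst.
  by apply: (@cvgB _ C _ (nbhs w)); [exact: cvg_id|exact: cvg_cst].
have p1 : 0 < I'.1 := lt_le_trans a0 h1.
have p2 := h2; have p4 := h5; have p3 : I'.2 <= 1 := le_trans h3 b1.
have -> : bdry_int f I' J' = bdry_int (fun w => f w - g w) I' J'.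
  by rewrite (bdry_intB _ cf cg p1 p2 p3) (bdry_int_affine _ _ p1 p2 p4) subr0.
pose M := e / (8 * K) * (2 * L).
have hM l t : I'.1 <= l <= I'.2 -> J'.1 <= t <= J'.2 ->
    normc (f (shrunk l t) - g (shrunk l t)) <= M.
  move=> hl ht; set w := shrunk l t.
  have -> : f w - g w = f w - f w0 - D * (w - w0) by rewrite /g; ring.
  have dist : normc (w - w0) <= 2 * L.
    have [x0 x1] : 0 <= x /\ x <= 1 by split; lra.
    apply: (le_trans (@shrunk_dist l t x y x0 x1)).
    rewrite ler_pM2l// /L lerD// ler_norml; lra.
  apply: (le_trans (hd _ _)); first by apply: (le_lt_trans dist); rewrite /L; lra.
  by rewrite /M ler_pM2l.
have cfg : cdcont (fun w => f w - g w).
  by move=> w w1; apply: (@cvgB _ C _ (nbhs w)); [exact: cf|exact: cg].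
apply: (le_trans (bdry_int_bound cfg p1 p2 p3 p4 hM)).
have L0 : 0 < L by rewrite /L addr_gt0 ?subr_gt0.
have hK : (1 - normc z)^-1 * (J'.2 - J'.1) + I'.1^-1 * (I'.2 - I'.1) <= K * L.
  rewrite /K /L.
  have qr : I'.1^-1 <= I.1^-1 by rewrite lef_pV2 ?posrE.
  have u1 : 0 <= I'.2 - I'.1 by rewrite subr_ge0 ltW.
  have u2 : 0 <= J'.2 - J'.1 by rewrite subr_ge0 ltW.
  have v1 := ler_wpM2r u1 qr.
  have v2 := mulr_ge0 (ltW z0) u1.
  have v3 := mulr_ge0 (ltW a0V) u2.
  by rewrite !mulrDl !mulrDr; lra.
have M0 : 0 < M by rewrite /M mulr_gt0// mulr_gt0.
apply: (@le_trans _ _ (4 * M * (K * L))); first by rewrite ler_pM2l// mulr_gt0.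
rewrite le_eqVlt; apply/orP; left; apply/eqP; rewrite /M.
by field; rewrite gt_eqF.
Qed.

(** On a full turn the two radii coincide, so that only the two circles are left
    in the boundary integral. *)
Lemma circle_cint_deform (l : R) : 0 < l <= 1 ->
  cint 0 (pi *+ 2) (fun t => f (expi t) * cauchy_kernel t) =
  cint 0 (pi *+ 2) (fun t => f (shrunk l t) * cauchy_kernel t).
Proof.
move=> /andP[l0]; rewrite le_eqVlt => /orP[/eqP ->|l1].
  by apply: eq_cint => t _; rewrite /shrunk rmorph1 mul1r addrC subrK.
have pi0 : 0 < (pi *+ 2 : R) by rewrite mulrn_wgt0// pi_gt0.
have := @bdry_int_eq0 (l, 1) (0, pi *+ 2) l0 l1 (lexx _) pi0.
have per l' : shrunk l' (pi *+ 2) = shrunk l' 0.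
  by rewrite /shrunk /expi cos2pi sin2pi cos0 sin0.
rewrite /bdry_int /=.
have -> : cint l 1 (fun l' => f (shrunk l' (pi *+ 2)) * l'%:C^-1) =
          cint l 1 (fun l' => f (shrunk l' 0) * l'%:C^-1).
  by apply: eq_cint => l' _; rewrite per.
rewrite subrr mulr0 addr0 => /eqP; rewrite subr_eq0 => /eqP <-.
by apply: eq_cint => t _; rewrite /shrunk rmorph1 mul1r addrC subrK.
Qed.

(** Letting the contracted circle shrink to [z] replaces [f] by [f z]. *)
Lemma circle_cint_center :
  cint 0 (pi *+ 2) (fun t => f (expi t) * cauchy_kernel t) =
  f z * cint 0 (pi *+ 2) cauchy_kernel.
Proof.
have pi0 : 0 < (pi *+ 2 : R) by rewrite mulrn_wgt0// pi_gt0.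
apply/eqP; rewrite -subr_eq0 -normc_eq0 eq_le normc_ge0 andbT.
apply/ler_addgt0Pr => e e0; rewrite add0r.
set K := (1 - normc z)^-1.
have K0 : 0 < K by rewrite invr_gt0.
have e'0 : 0 < e / (2 * K * (pi *+ 2)) by rewrite divr_gt0// mulr_gt0// mulr_gt0.
have /cplx_continuousP /(_ _ e'0) /near_normc[d d0 hd] := cf (ltW z1).
pose l := Num.min 1 (d / 4).
have l0 : 0 < l by rewrite lt_min ltr01 divr_gt0.
have l1 : l <= 1 by rewrite ge_min lexx.
have ld : l <= d / 4 by rewrite ge_min lexx orbT.
rewrite (@circle_cint_deform l) ?l0//.
have cc := @itv_cont_cauchy_kernel 0 (pi *+ 2).
rewrite -cintZ//.
rewrite -cintB; last 2 first.
- by apply: itv_cont_arc => //; exact: ltW.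
- by apply: itv_contM cc; exact: itv_cont_cst.
apply: (le_trans (@cint_bound _ _ _ _ (e / (2 * K * (pi *+ 2)) * K) pi0 _ _)).
- apply: itv_contD; first by apply: itv_cont_arc => //; exact: ltW.
  move=> t ht; apply: (@cvgN _ C).
  by apply: (@cvgM C); [exact: cvg_cst|exact: cc].
- move=> t _; rewrite -mulrBl Normc.normcM ler_pM ?normc_ge0 ?cauchy_kernel_le//.
  rewrite normc_distC; apply/ltW/hd.
  rewrite /shrunk addrC addKr Normc.normcM normc_real gtr0_norm//.
  have : normc (expi t - z) <= 2.
    by apply: (le_trans (ler_normcD _ _)); rewrite normcN normc_expi; have := z1'; lra.
  have := normc_ge0 (expi t - z); nra.
rewrite subr0 le_eqVlt; apply/orP; left; apply/eqP.
move: (pi *+ 2) pi0 => P P0; field.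
by rewrite (gt_eqF K0) (gt_eqF P0).
Qed.

End goursat.

(** * Means over the unit circle and the Cauchy formula *)
Lemma circle_integralE (R : realType) (g : Cplx R -> Cplx R) :
  circle_integral g = ((pi *+ 2)^-1)%:C * cint 0 (pi *+ 2) (fun t => g (expi t)).
Proof.
rewrite /circle_integral cintE.
by apply/eqP; rewrite eq_complex /= !mul0r subr0 addr0 !eqxx.
Qed.

(* The same precaution as for [cint]. *)
Opaque circle_integral.

Section circle_mean.
Variable R : realType.
Local Notation normc := Normc.normc.
Local Notation C := (Cplx R).
Implicit Types (f g h : C -> C) (z : C).

Let pi20 : 0 < (pi *+ 2 : R).
Proof. by rewrite mulrn_wgt0// pi_gt0. Qed.

Definition circle_cont g := forall t : R, {for t, continuous (fun t => g (expi t))}.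

Lemma circle_cont_itv g a b : circle_cont g -> itv_cont a b (fun t => g (expi t)).
Proof. by move=> cg t _; exact: cg. Qed.

Lemma eq_circle_integral g h : (forall w, normc w = 1 -> g w = h w) ->
  circle_integral g = circle_integral h.
Proof.
move=> gh; rewrite !circle_integralE; congr (_ * _).
by apply: eq_cint => t _; rewrite gh ?normc_expi.
Qed.

Lemma circle_contD g h : circle_cont g -> circle_cont h ->
  circle_cont (fun w => g w + h w).
Proof. by move=> cg ch t; apply: (@cvgD _ C); [exact: cg|exact: ch]. Qed.

Lemma circle_contM g h : circle_cont g -> circle_cont h ->
  circle_cont (fun w => g w * h w).
Proof. by move=> cg ch t; apply: (@cvgM C); [exact: cg|exact: ch]. Qed.

Lemma circle_contN g : circle_cont g -> circle_cont (fun w => - g w).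
Proof. by move=> cg t; apply: (@cvgN _ C); exact: cg. Qed.

Lemma circle_contB g h : circle_cont g -> circle_cont h ->
  circle_cont (fun w => g w - h w).
Proof. by move=> cg ch; apply: circle_contD cg (circle_contN ch). Qed.

Lemma circle_cont_cst z : circle_cont (fun=> z).
Proof. by move=> t; exact: cvg_cst. Qed.

Lemma circle_cont_id : circle_cont id.
Proof. by move=> t; exact: continuous_expi. Qed.

Lemma circle_contV g : circle_cont g -> (forall w, normc w = 1 -> g w != 0) ->
  circle_cont (fun w => (g w)^-1).
Proof.
by move=> cg g0 t; apply: (@cvgV C); [apply: g0; exact: normc_expi|exact: cg].
Qed.

Lemma circle_cont_conj g : circle_cont g -> circle_cont (fun w => conjc (g w)).
Proof. by move=> cg t; apply: continuous_conjc; exact: cg. Qed.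

Lemma circle_contX g n : circle_cont g -> circle_cont (fun w => g w ^+ n).
Proof.
move=> cg; elim: n => [|n IH]; first exact: circle_cont_cst.
have -> : (fun w => g w ^+ n.+1) = (fun w => g w * g w ^+ n).
  by apply/funext => w; rewrite exprS.
exact: circle_contM.
Qed.

Lemma circle_cont_hol f : hol_cdisk f -> circle_cont f.
Proof.
move=> hf t; apply: (@continuous_comp _ _ _ (@expi R) f).
  exact: continuous_expi.
by apply: hol_cdisk_continuous => //; rewrite /closed_disk /= normc_re normc_expi.
Qed.

Lemma circle_integralD g h : circle_cont g -> circle_cont h ->
  circle_integral (fun w => g w + h w) = circle_integral g + circle_integral h.
Proof.
move=> cg ch; rewrite !circle_integralE cintD; first by rewrite mulrDr.
- exact: circle_cont_itv.
- exact: circle_cont_itv.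
Qed.

Lemma circle_integralB g h : circle_cont g -> circle_cont h ->
  circle_integral (fun w => g w - h w) = circle_integral g - circle_integral h.
Proof.
move=> cg ch; rewrite !circle_integralE cintB; first by rewrite mulrBr.
- exact: circle_cont_itv.
- exact: circle_cont_itv.
Qed.

Lemma circle_integralZ z g : circle_cont g ->
  circle_integral (fun w => z * g w) = z * circle_integral g.
Proof.
move=> cg; rewrite !circle_integralE cintZ; first by rewrite mulrCA.
exact: circle_cont_itv.
Qed.

Lemma circle_integral_cst z : circle_integral (fun=> z) = z.
Proof.
rewrite circle_integralE cint_cst// subr0 mulrA -rmorphM mulVf ?gt_eqF//.
by rewrite rmorph1 mul1r.
Qed.

Lemma circle_integral_sum (u : nat -> C -> C) N : (forall n, circle_cont (u n)) ->
  circle_cont (fun w => \sum_(0 <= n < N) u n w) /\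
  circle_integral (fun w => \sum_(0 <= n < N) u n w) =
  \sum_(0 <= n < N) circle_integral (u n).
Proof.
move=> cu; elim: N => [|N [IH1 IH2]].
  rewrite big_geq//; have -> : (fun w => \sum_(0 <= n < 0) u n w) = fun=> 0.
    by apply/funext => w; rewrite big_geq.
  by rewrite circle_integral_cst; split; first exact: circle_cont_cst.
have -> : (fun w => \sum_(0 <= n < N.+1) u n w) =
          (fun w => \sum_(0 <= n < N) u n w + u N w).
  by apply/funext => w; rewrite big_nat_recr.
have E := circle_integralD IH1 (cu N).
split.
  exact: (circle_contD IH1 (cu N)).
rewrite E.
rewrite IH2.
rewrite [RHS]big_nat_recr.
  reflexivity.
exact: leq0n.
Qed.

Lemma circle_integral_conj g : circle_cont g ->
  circle_integral (fun w => conjc (g w)) = conjc (circle_integral g).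
Proof.
move=> cg; rewrite !circle_integralE cint_conj; last exact: circle_cont_itv.
by rewrite rmorphM /= oppr0.
Qed.

Lemma circle_integral_bound g (M : R) : circle_cont g ->
  (forall t, 0 <= t <= pi *+ 2 -> normc (g (expi t)) <= M) ->
  normc (circle_integral g) <= 2 * M.
Proof.
move=> cg gM; rewrite circle_integralE Normc.normcM normc_real.
rewrite gtr0_norm ?invr_gt0// ler_pdivrMl// mulrC.
have := @cint_bound _ 0 (pi *+ 2) (fun t => g (expi t)) M pi20.
rewrite subr0; apply; first exact: circle_cont_itv.
exact: gM.
Qed.

Lemma circle_bounded g : circle_cont g ->
  exists2 M : R, 0 < M & forall t, 0 <= t <= pi *+ 2 -> normc (g (expi t)) <= M.
Proof.
move=> cg.
have cn : {within `[0, pi *+ 2], continuous (fun t => normc (g (expi t)) : R)}.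
  apply: continuous_in_subspaceT => t _.
  apply: (@continuous_comp _ _ _ (fun t => g (expi t)) (fun w : C => normc w)).
    exact: cg.
  exact: normc_continuous.
have [c _ hc] := EVT_max (ltW pi20) cn.
exists (normc (g (expi c)) + 1); first by rewrite ltr_wpDl ?normc_ge0.
by move=> t ht; apply: (le_trans (hc t _)); rewrite ?lerDl// in_itv.
Qed.

Lemma hol_cdisk_derivable f : hol_cdisk f ->
  forall w : C, normc w <= 1 -> derivable f w 1.
Proof.
move=> [U [_ DU dU]] w w1; apply/dU/DU.
by rewrite /closed_disk /= normc_re (lecR _ 1).
Qed.

Lemma mean_value f : hol_cdisk f -> circle_integral f = f 0.
Proof.
move=> hf; have z1 : normc (0 : C) < 1 by rewrite Normc.normc0.
have := circle_cint_center z1 (hol_cdisk_derivable hf).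
have k1 t : cauchy_kernel 0 t = 1 :> C by rewrite /cauchy_kernel subr0 divff// expi_neq0.
have -> : cint 0 (pi *+ 2) (cauchy_kernel 0) = (pi *+ 2)%:C :> C.
  rewrite -[RHS]mulr1 -[X in _ = X%:C * _]subr0 -cint_cst//.
  by apply: eq_cint => t _; rewrite k1.
rewrite (_ : cint _ _ _ = cint 0 (pi *+ 2) (fun t => f (expi t))); last first.
  by apply: eq_cint => t _; rewrite k1 mulr1.
rewrite circle_integralE => ->.
by rewrite mulrCA -rmorphM mulVf ?gt_eqF// rmorph1 mulr1.
Qed.

Lemma circle_sub_neq0 z w : normc z < 1 -> normc w = 1 -> w - z != 0.
Proof.
move=> z1 w1; rewrite subr_eq0; apply/eqP => E.
by move: z1; rewrite -E w1 ltxx.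
Qed.

Lemma circle_neq0 (w : C) : normc w = 1 -> w != 0.
Proof. by move=> w1; rewrite -normc_eq0 w1 oner_eq0. Qed.

(** On the circle the conjugate of [w] is [w^-1]: this turns the Cauchy kernel,
    which has a pole in the disk, into the conjugate of a function that is
    analytic there, to which the mean value property applies. *)
Lemma kernel_conj z w : normc z < 1 -> normc w = 1 ->
  w / (w - z) = conjc ((1 - conjc z * w)^-1).
Proof.
move=> z1 w1; rewrite conjc_inv.
have -> : conjc (1 - conjc z * w) = 1 - z * conjc w.
  case: z w {z1 w1} => [a b] [c d].
  by apply/eqP; rewrite eq_complex /=; apply/andP; split; apply/eqP; ring.
rewrite (normc1_conjV w1).
have w0 := circle_neq0 w1; have wz := circle_sub_neq0 z1 w1.
have wz' : 1 - z / w != 0.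
  by apply: contra wz => /eqP h; rewrite -(divff w0) -mulrBl in h;
     move/eqP: h; rewrite mulf_eq0 invr_eq0 (negPf w0) orbF.
by field; rewrite w0 wz.
Qed.

Lemma circle_cont_kernel z : normc z < 1 -> circle_cont (fun w => w / (w - z)).
Proof.
move=> z1; apply: circle_contM; first exact: circle_cont_id.
apply: circle_contV; last by move=> w; exact: circle_sub_neq0.
by apply: circle_contB; [exact: circle_cont_id|exact: circle_cont_cst].
Qed.

Lemma hol_cdisk_kernel z : normc z < 1 -> hol_cdisk (fun w : C => (1 - conjc z * w)^-1).
Proof.
move=> z1; apply: hol_cdisk_inv.
  have := hol_cdisk_affine (- conjc z) 1.
  by congr hol_cdisk; apply/funext => w; rewrite mulNr.
move=> w hw; apply: blaschke_denom_neq0 => //.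
by rewrite /unit_disk /= normc_re (ltcR _ 1).
Qed.

(** The Cauchy transform: on the unit circle, w / (w - z) times the normalized
    measure is dw / (2 pi i (w - z)). *)
Definition cauchy g z := circle_integral (fun w => g w * (w / (w - z))).

(** The conjugate of an analytic function has only Fourier coefficients of index
    at most 0, so only its mean survives the Cauchy transform. *)
Lemma cauchy_conj f z : hol_cdisk f -> normc z < 1 ->
  cauchy (fun w => conjc (f w)) z = conjc (f 0).
Proof.
move=> hf z1; rewrite /cauchy.
have hfk := hol_cdisk_mul hf (hol_cdisk_kernel z1).
rewrite (@eq_circle_integral _ (fun w => conjc (f w * (1 - conjc z * w)^-1))).
  rewrite circle_integral_conj; last exact: circle_cont_hol.
  by rewrite mean_value// mulr0 subr0 invr1 mulr1.
by move=> w w1; rewrite kernel_conj// rmorphM.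
Qed.

(** [circle_cint_center] leaves the integral of the bare kernel; the case of a
    constant function in [cauchy_conj] evaluates it. *)
Lemma cauchy_formula f z : hol_cdisk f -> normc z < 1 -> cauchy f z = f z.
Proof.
move=> hf z1; rewrite /cauchy circle_integralE.
rewrite (circle_cint_center z1 (hol_cdisk_derivable hf)) mulrCA.
have := cauchy_conj (hol_cdisk_cst 1) z1.
rewrite /cauchy circle_integralE conjc1.
rewrite (_ : cint _ _ _ = cint 0 (pi *+ 2) (cauchy_kernel z)); last first.
  by apply: eq_cint => t _; rewrite mul1r.
by move=> ->; rewrite mulr1.
Qed.

Lemma kernel_bound z w : normc z < 1 -> normc w = 1 ->
  normc (w / (w - z)) <= (1 - normc z)^-1.
Proof.
move=> z1 w1; rewrite Normc.normcM Normc.normcV w1 mul1r.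
have h : 1 - normc z <= normc (w - z) by rewrite -w1 ler_normcB.
have h0 : 0 < 1 - normc z by rewrite subr_gt0.
by rewrite lef_pV2 ?posrE// (lt_le_trans h0).
Qed.

Lemma cauchy_bound g z (M : R) : circle_cont g -> normc z < 1 ->
  (forall t, 0 <= t <= pi *+ 2 -> normc (g (expi t)) <= M) ->
  normc (cauchy g z) <= 2 * (M * (1 - normc z)^-1).
Proof.
move=> cg z1 gM; apply: circle_integral_bound.
  by apply: circle_contM cg _; exact: circle_cont_kernel.
move=> t ht; rewrite Normc.normcM ler_pM ?normc_ge0 ?gM//.
by apply: kernel_bound => //; exact: normc_expi.
Qed.

Lemma circle_cont_exprz (n : nat) : circle_cont (fun w : C => w ^ (- n%:Z)).
Proof.
have -> : (fun w : C => w ^ (- n%:Z)) = (fun w => (w ^+ n)^-1).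
  by apply/funext => w; rewrite -exprnN.
apply: circle_contV => [|w w1]; first by apply: circle_contX; exact: circle_cont_id.
by rewrite expf_neq0// circle_neq0.
Qed.

(** The partial sums of the Taylor series amount to truncating the geometric
    series of the Cauchy kernel. *)
Lemma riesz_projection_partial g z N : circle_cont g -> normc z < 1 ->
  series (fun n : nat => fourier_coef g n%:Z * z ^+ n : C) N =
  cauchy (fun w => g w * (1 - (z / w) ^+ N)) z.
Proof.
move=> cg z1.
have cq n : circle_cont (fun w => (z / w) ^+ n).
  apply: circle_contX; apply: circle_contM; first exact: circle_cont_cst.
  by apply: circle_contV; [exact: circle_cont_id|exact: circle_neq0].
rewrite /series /=; elim: N => [|N IH].
  rewrite big_geq// /cauchy (@eq_circle_integral _ (fun=> 0)).
    by rewrite circle_integral_cst.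
  by move=> w _; rewrite expr0 subrr mulr0 mul0r.
rewrite big_nat_recr//= IH /fourier_coef mulrC -circle_integralZ; last first.
  by apply: circle_contM cg _; exact: circle_cont_exprz.
rewrite /cauchy -circle_integralD.
- apply: eq_circle_integral => w w1.
  have w0 := circle_neq0 w1; have wz := circle_sub_neq0 z1 w1.
  rewrite -exprnN exprS !expr_div_n.
  have wN : w ^+ N != 0 by rewrite expf_neq0.
  move: (w ^+ N) (z ^+ N) (g w) wN => W Z G W0.
  by field; rewrite w0 wz W0.
- apply: circle_contM; last exact: circle_cont_kernel.
  by apply: circle_contM cg _; apply: circle_contB; [exact: circle_cont_cst|].
- apply: circle_contM; first exact: circle_cont_cst.
  by apply: circle_contM cg _; exact: circle_cont_exprz.
Qed.

Lemma cauchyB g h z : circle_cont g -> circle_cont h -> normc z < 1 ->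
  cauchy (fun w => g w - h w) z = cauchy g z - cauchy h z.
Proof.
move=> cg ch z1; have ck := circle_cont_kernel z1.
rewrite /cauchy -(circle_integralB (circle_contM cg ck) (circle_contM ch ck)).
by apply: eq_circle_integral => w _; rewrite mulrBl.
Qed.

Lemma eq_cauchy g h z : (forall w, normc w = 1 -> g w = h w) ->
  cauchy g z = cauchy h z.
Proof. by move=> gh; rewrite /cauchy; apply: eq_circle_integral => w w1; rewrite gh. Qed.

Lemma cauchyZ c g z : circle_cont g -> normc z < 1 ->
  cauchy (fun w => c * g w) z = c * cauchy g z.
Proof.
move=> cg z1; have ck := circle_cont_kernel z1.
rewrite /cauchy -(circle_integralZ _ (circle_contM cg ck)).
by apply: eq_circle_integral => w _; rewrite -mulrA.
Qed.

Lemma cauchy_sum (u : nat -> C -> C) N z : (forall n, circle_cont (u n)) ->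
  normc z < 1 ->
  cauchy (fun w => \sum_(0 <= n < N) u n w) z = \sum_(0 <= n < N) cauchy (u n) z.
Proof.
move=> cu z1; have ck := circle_cont_kernel z1.
have [_ <-] := circle_integral_sum N (fun n => circle_contM (cu n) ck).
by apply: eq_circle_integral => w _; rewrite big_distrl.
Qed.

Lemma geometric_small (r e : R) : 0 <= r -> r < 1 -> 0 < e ->
  \forall N \near \oo, r ^+ N < e.
Proof.
move=> r0 r1 e0.
have rn : `|r| < 1 by rewrite ger0_norm.
have /(@cvgrPdist_lt _ R^o) /(_ _ e0) := cvg_expr rn.
by apply: filterS => N; rewrite sub0r normrN ger0_norm// exprn_ge0.
Qed.

Lemma riesz_projectionE g z : circle_cont g -> normc z < 1 ->
  riesz_projection g z = cauchy g z.
Proof.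
move=> cg z1; apply: cvg_lim; first exact: norm_hausdorff.
apply/cplx_cvgP => e e0.
have [M M0 gM] := circle_bounded cg.
have h0 : 0 < (1 - normc z)^-1 by rewrite invr_gt0 subr_gt0.
have e'0 : 0 < e / (2 * (M * (1 - normc z)^-1)) by rewrite divr_gt0// !mulr_gt0.
have := geometric_small (normc_ge0 z) z1 e'0; apply: filterS => N.
rewrite ltr_pdivlMr ?mulr_gt0// => hN.
have cq : circle_cont (fun w => (z / w) ^+ N).
  apply: circle_contX; apply: circle_contM; first exact: circle_cont_cst.
  by apply: circle_contV; [exact: circle_cont_id|exact: circle_neq0].
have cg' : circle_cont (fun w => g w * (1 - (z / w) ^+ N)).
  by apply: circle_contM cg _; apply: circle_contB; [exact: circle_cont_cst|].
rewrite (riesz_projection_partial _ cg z1) -(cauchyB cg cg' z1).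
rewrite (@eq_cauchy _ (fun w => g w * (z / w) ^+ N)); last first.
  by move=> w _; rewrite mulrBr mulr1 opprB addrC subrK.
apply: le_lt_trans hN.
rewrite [leRHS](_ : _ = 2 * (M * normc z ^+ N * (1 - normc z)^-1)); last by ring.
apply: (cauchy_bound (circle_contM cg cq) z1).
move=> t ht; rewrite Normc.normcM normcX Normc.normcM Normc.normcV normc_expi.
by rewrite invr1 mulr1 ler_wpM2r ?exprn_ge0 ?normc_ge0// gM.
Qed.

End circle_mean.

(** * Finite Blaschke products *)
Section blaschke_algebra.
Variable R : realType.
Local Notation normc := Normc.normc.
Local Notation C := (Cplx R).
Implicit Types (l z w : C) (lam : nat -> C).

Lemma unit_diskE z : unit_disk z = (normc z < 1) :> Prop.
Proof. by rewrite /unit_disk /= normc_re (ltcR _ 1). Qed.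

Lemma closed_diskE z : closed_disk z = (normc z <= 1) :> Prop.
Proof. by rewrite /closed_disk /= normc_re (lecR _ 1). Qed.

Lemma normc_sqr (a b : R) : normc (a +i* b) ^+ 2 = a ^+ 2 + b ^+ 2.
Proof. by rewrite /= sqr_sqrtr// addr_ge0 ?sqr_ge0. Qed.

(** For |l| < 1 this compares numerator and denominator of a Blaschke factor: its
    modulus is less than 1 inside the disk, 1 on the circle, and more than 1
    outside. *)
Lemma blaschke_factor_sqr l z :
  normc (1 - conjc l * z) ^+ 2 - normc (l - z) ^+ 2 =
  (1 - normc l ^+ 2) * (1 - normc z ^+ 2).
Proof.
case: l z => [a b] [c d].
have -> : 1 - conjc (a +i* b) * (c +i* d) =
  (1 - (a * c + b * d)) +i* - (a * d - b * c) :> R[i].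
  by apply/eqP; rewrite eq_complex /=; apply/andP; split; apply/eqP; ring.
have -> : (a +i* b) - (c +i* d) = (a - c) +i* (b - d) :> R[i] by [].
by rewrite !normc_sqr; ring.
Qed.

Lemma blaschke_den_neq0 l z : normc l < 1 -> normc z <= 1 -> 1 - conjc l * z != 0.
Proof. by rewrite -unit_diskE -closed_diskE; exact: blaschke_denom_neq0. Qed.

Lemma normc_sqr_le (x y : C) : (normc x <= normc y) = (normc x ^+ 2 <= normc y ^+ 2).
Proof. by rewrite ler_pXn2r ?nnegrE ?normc_ge0. Qed.

Lemma blaschke_factor_le1 l z : normc l < 1 -> normc z <= 1 ->
  normc ((l - z) / (1 - conjc l * z)) <= 1.
Proof.
move=> l1 z1; rewrite Normc.normcM Normc.normcV.
rewrite ler_pdivrMr ?mul1r; last by rewrite normc_gt0 blaschke_den_neq0.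
rewrite normc_sqr_le -subr_ge0 blaschke_factor_sqr.
by rewrite mulr_ge0// subr_ge0 exprn_ile1 ?normc_ge0// ltW.
Qed.

Lemma blaschke_factor_eq1 l z : normc l < 1 -> normc z = 1 ->
  normc ((l - z) / (1 - conjc l * z)) = 1.
Proof.
move=> l1 z1; have d0 : 1 - conjc l * z != 0 by rewrite blaschke_den_neq0// z1.
rewrite Normc.normcM Normc.normcV.
have /eqP := blaschke_factor_sqr l z.
rewrite z1 expr1n subrr mulr0 subr_eq0 eqrXn2 ?normc_ge0// => /eqP <-.
by rewrite mulfV// normc_eq0.
Qed.

Lemma blaschkeS lam n z : blaschke lam n.+1 z =
  blaschke lam n z * ((lam n.+1 - z) / (1 - conjc (lam n.+1) * z)).
Proof. by rewrite /blaschke big_nat_recr. Qed.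

Lemma blaschke0 lam z : blaschke lam 0 z = 1.
Proof. by rewrite /blaschke big_geq. Qed.

Lemma blaschkeD lam n p z : blaschke lam (n + p) z =
  blaschke lam n z * blaschke (fun k => lam (n + k)%N) p z.
Proof.
elim: p => [|p IH]; first by rewrite addn0 blaschke0 mulr1.
by rewrite addnS !blaschkeS IH -mulrA addnS.
Qed.

Lemma blaschke_root lam n : blaschke lam n.+1 (lam 1) = 0.
Proof. by rewrite -[n.+1]add1n blaschkeD blaschkeS subrr mul0r mulr0 mul0r. Qed.

Variable lam : nat -> C.
Hypothesis hlam : forall k, (1 <= k)%N -> unit_disk (lam k).

Let lam1 k : (1 <= k)%N -> normc (lam k) < 1.
Proof. by move=> /hlam; rewrite unit_diskE. Qed.

Lemma blaschke_le1 n z : normc z <= 1 -> normc (blaschke lam n z) <= 1.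
Proof.
move=> z1; elim: n => [|n IH]; first by rewrite blaschke0 Normc.normc1.
rewrite blaschkeS Normc.normcM mulr_ile1 ?normc_ge0//.
exact: blaschke_factor_le1 (lam1 _) z1.
Qed.

Lemma blaschke_circle n z : normc z = 1 -> normc (blaschke lam n z) = 1.
Proof.
move=> z1; elim: n => [|n IH]; first by rewrite blaschke0 Normc.normc1.
by rewrite blaschkeS Normc.normcM IH mul1r blaschke_factor_eq1// lam1.
Qed.

Lemma blaschke_circle_cont n : circle_cont (blaschke lam n).
Proof. by apply: circle_cont_hol; exact: hol_cdisk_blaschke. Qed.

End blaschke_algebra.

(** * The coefficient functionals *)
Section coefficients.
Variable R : realType.
Local Notation normc := Normc.normc.
Local Notation C := (Cplx R).
Variable lam : nat -> C.
Hypothesis hlam : forall k, (1 <= k)%N -> unit_disk (lam k).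

Let lam1 k : (1 <= k)%N -> normc (lam k) < 1.
Proof. by move=> /hlam; rewrite unit_diskE. Qed.

Let hlamD n k : (1 <= k)%N -> unit_disk (lam (n + k)).
Proof. by move=> k1; apply: hlam; rewrite (leq_trans k1)// leq_addl. Qed.

(** The value at [lam m.+1] of the Toeplitz operator with symbol the conjugate
    of [blaschke lam m]; see [toeplitz_coefE]. *)
Definition toeplitz_coef m (f : C -> C) : C :=
  cauchy (fun w => conjc (blaschke lam m w) * f w) (lam m.+1).

Definition blaschke_coef n (f : C -> C) : C :=
  toeplitz_coef n f - (if n is m.+1 then conjc (lam n) * toeplitz_coef m f else 0).

Lemma toeplitz_coefE m (f : C -> C) : hol_cdisk f ->
  toeplitz (fun zeta => conjc (blaschke lam m zeta)) f (lam m.+1) = toeplitz_coef m f.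
Proof.
move=> hf; apply: riesz_projectionE; last exact: lam1.
apply: circle_contM (circle_cont_hol hf).
by apply: circle_cont_conj; exact: blaschke_circle_cont.
Qed.

Lemma toeplitz_coef_cont m (f : C -> C) : circle_cont f ->
  circle_cont (fun w => conjc (blaschke lam m w) * f w).
Proof.
by apply: circle_contM; apply: circle_cont_conj; exact: blaschke_circle_cont.
Qed.

Lemma toeplitz_coefB m (f g : C -> C) : circle_cont f -> circle_cont g ->
  toeplitz_coef m (fun w => f w - g w) = toeplitz_coef m f - toeplitz_coef m g.
Proof.
move=> cf cg; rewrite /toeplitz_coef.
rewrite -(cauchyB (@toeplitz_coef_cont m _ cf) (@toeplitz_coef_cont m _ cg) (lam1 (ltn0Sn m))).
by apply: eq_cauchy => w _; rewrite mulrBr.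
Qed.

Lemma toeplitz_coef_sum m (a : nat -> C) N :
  toeplitz_coef m (fun w => \sum_(0 <= n < N) a n * blaschke lam n w) =
  \sum_(0 <= n < N) a n * toeplitz_coef m (blaschke lam n).
Proof.
have cB n := @toeplitz_coef_cont m _ (@blaschke_circle_cont _ lam hlam n).
pose u n (w : C) := a n * (conjc (blaschke lam m w) * blaschke lam n w).
have cu n : circle_cont (u n).
  by apply: circle_contM (cB n); exact: circle_cont_cst.
transitivity (cauchy (fun w => \sum_(0 <= n < N) u n w) (lam m.+1)).
  apply: eq_cauchy => w _; rewrite mulr_sumr; apply: eq_bigr => n _.
  by rewrite /u mulrCA.
rewrite (cauchy_sum N cu (lam1 (ltn0Sn m))); apply: eq_bigr => n _.
by rewrite (cauchyZ _ (cB n) (lam1 (ltn0Sn m))).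
Qed.

Lemma toeplitz_coef_bound m (f : C -> C) (e : R) : circle_cont f ->
  (forall w, normc w = 1 -> normc (f w) <= e) ->
  normc (toeplitz_coef m f) <= 2 * (e * (1 - normc (lam m.+1))^-1).
Proof.
move=> cf fe; apply: (cauchy_bound (@toeplitz_coef_cont m _ cf) (lam1 (ltn0Sn m))).
move=> t _; rewrite Normc.normcM normc_conj.
by rewrite (blaschke_circle hlam) ?mul1r ?fe ?normc_expi.
Qed.

Lemma conj_blaschke_circle n w : normc w = 1 ->
  conjc (blaschke lam n w) * blaschke lam n w = 1.
Proof.
move=> w1; have B1 := blaschke_circle hlam n w1.
by rewrite (normc1_conjV B1) mulVf// circle_neq0.
Qed.

(** On the circle the conjugate of B_m cancels the first m factors of
    B_(m+p+1); the first of the remaining ones vanishes at [lam m.+1]. *)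
Lemma toeplitz_coef_gt m p : toeplitz_coef m (blaschke lam (m + p.+1)) = 0.
Proof.
pose G : C -> C := blaschke (fun k => lam (m + k)%N) p.+1.
have hG : hol_cdisk G by exact: hol_cdisk_blaschke (hlamD m) _.
transitivity (cauchy G (lam m.+1)).
  apply: eq_cauchy => w w1; rewrite blaschkeD mulrA conj_blaschke_circle//.
  by rewrite mul1r.
rewrite (cauchy_formula hG (lam1 (ltn0Sn m))) /G.
by have := blaschke_root (fun k => lam (m + k)%N) p; rewrite addn1.
Qed.

(** Here B_n cancels against the first n factors of the conjugate of B_(n+p);
    what is left is the conjugate of an analytic function. *)
Lemma toeplitz_coef_le n p : toeplitz_coef (n + p) (blaschke lam n) =
  conjc (blaschke (fun k => lam (n + k)%N) p 0).
Proof.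
pose G : C -> C := blaschke (fun k => lam (n + k)%N) p.
have hG : hol_cdisk G by exact: hol_cdisk_blaschke (hlamD n) _.
rewrite -(cauchy_conj hG (lam1 (ltn0Sn (n + p)))).
apply: eq_cauchy => w w1; rewrite blaschkeD rmorphM mulrAC /=.
by rewrite conj_blaschke_circle// mul1r.
Qed.

(** The functionals are dual to the Blaschke products.  For n < m the two terms
    cancel because passing from m - 1 to m multiplies the product at 0 in
    [toeplitz_coef_le] by [lam m]. *)
Lemma blaschke_coef_blaschke m n : blaschke_coef m (blaschke lam n) = (n == m)%:R.
Proof.
rewrite /blaschke_coef; have [nm|mn|->] := ltngtP n m.
- case: m nm => [//|m]; rewrite ltnS => nm.
  rewrite -(subnKC nm) -addnS !toeplitz_coef_le blaschkeS !subr0 mulr0 subr0 invr1 mulr1.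
  by rewrite addnS rmorphM /= mulrC subrr.
- have e1 : toeplitz_coef m (blaschke lam n) = 0.
    by have := toeplitz_coef_gt m (n - m.+1)%N; rewrite addnS -addSn subnKC.
  rewrite e1; case: m mn {e1} => [_|m mn]; first by rewrite subr0.
  have -> : toeplitz_coef m (blaschke lam n) = 0.
    have := toeplitz_coef_gt m (n - m.+1)%N; rewrite addnS -addSn subnKC//.
    exact: ltnW.
  by rewrite mulr0 subr0.
- have -> : toeplitz_coef m (blaschke lam m) = 1.
    by have := toeplitz_coef_le m 0; rewrite addn0 blaschke0 conjc1.
  case: m => [|m]; first by rewrite subr0.
  by have := toeplitz_coef_gt m 0; rewrite addn1 => ->; rewrite mulr0 subr0.
Qed.

Lemma blaschke_coef_sum m (a : nat -> C) N : (m < N)%N ->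
  blaschke_coef m (fun w => \sum_(0 <= n < N) a n * blaschke lam n w) = a m.
Proof.
move=> mN.
transitivity (\sum_(0 <= n < N) a n * blaschke_coef m (blaschke lam n)).
  rewrite /blaschke_coef; case: m {mN} => [|m].
    rewrite subr0 toeplitz_coef_sum; apply: eq_bigr => n _; by rewrite subr0.
  rewrite !toeplitz_coef_sum mulr_sumr -sumrB; apply: eq_bigr => n _.
  by rewrite mulrBr mulrCA.
rewrite (bigD1_seq m) ?mem_index_iota ?iota_uniq//= blaschke_coef_blaschke eqxx mulr1.
rewrite big1 ?addr0// => n /negPf nm.
by rewrite blaschke_coef_blaschke nm mulr0.
Qed.

Lemma blaschke_coefB m (f g : C -> C) : circle_cont f -> circle_cont g ->
  blaschke_coef m (fun w => f w - g w) = blaschke_coef m f - blaschke_coef m g.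
Proof.
move=> cf cg; rewrite /blaschke_coef; case: m => [|m].
  by rewrite (toeplitz_coefB _ cf cg) !subr0.
rewrite !(toeplitz_coefB _ cf cg).
by do 4!move: (toeplitz_coef _ _) => ?; ring.
Qed.

Lemma blaschke_coef_bound m : exists2 K : R, 0 < K &
  forall (f : C -> C) (e : R), 0 <= e -> circle_cont f ->
  (forall w, normc w = 1 -> normc (f w) <= e) -> normc (blaschke_coef m f) <= K * e.
Proof.
have k0 n : 0 < (1 - normc (lam n.+1))^-1 by rewrite invr_gt0 subr_gt0 lam1.
case: m => [|m].
  exists (2 * (1 - normc (lam 1))^-1); first by rewrite mulr_gt0.
  move=> f e _ cf fe; rewrite /blaschke_coef subr0.
  apply: (le_trans (toeplitz_coef_bound 0 cf fe)); rewrite le_eqVlt; apply/orP; left.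
  by apply/eqP; ring.
exists (2 * (1 - normc (lam m.+2))^-1 + 2 * (1 - normc (lam m.+1))^-1).
  by rewrite addr_gt0// mulr_gt0.
move=> f e e0 cf fe; rewrite /blaschke_coef.
apply: (le_trans (ler_normcD _ _)); rewrite normcN Normc.normcM normc_conj mulrDl.
apply: lerD.
  by apply: (le_trans (toeplitz_coef_bound m.+1 cf fe)); rewrite mulrAC -!mulrA.
rewrite -[leRHS]mul1r ler_pM ?normc_ge0//; first by apply/ltW/lam1.
by apply: (le_trans (toeplitz_coef_bound m cf fe)); rewrite mulrAC -!mulrA.
Qed.

(** The functional [blaschke_coef m] is bounded for the sup norm on the circle,
    so it can be applied term by term to a uniformly convergent expansion. *)
Lemma blaschke_coef_unique (f : C -> C) (a : nat -> C) : hol_cdisk f ->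
  (forall e : R, 0 < e -> \forall N \near \oo, forall z, normc z <= 1 ->
     normc (f z - \sum_(0 <= n < N) a n * blaschke lam n z) < e) ->
  forall m, a m = blaschke_coef m f.
Proof.
move=> hf H m; apply/esym/eqP; rewrite -subr_eq0 -normc_eq0 eq_le normc_ge0 andbT.
apply/ler_addgt0Pr => e e0; rewrite add0r.
have [K K0 hK] := blaschke_coef_bound m.
have e'0 : 0 < e / K by rewrite divr_gt0.
have [N0 _ hN] := H _ e'0.
pose N := maxn N0 m.+1.
have mN : (m < N)%N by rewrite leq_max leqnn orbT.
have cS : circle_cont (fun w => \sum_(0 <= n < N) a n * blaschke lam n w).
  have cu n : circle_cont (fun w => a n * blaschke lam n w).
    by apply: circle_contM (@blaschke_circle_cont _ lam hlam n); exact: circle_cont_cst.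
  by have [] := circle_integral_sum N cu.
have cf := circle_cont_hol hf.
rewrite -(blaschke_coef_sum a mN) -(blaschke_coefB _ cf cS).
have -> : e = K * (e / K) by rewrite mulrC divfK// gt_eqF.
apply: hK; first exact: ltW.
  exact: circle_contB.
move=> w w1; apply/ltW/hN; last by rewrite w1.
by rewrite /= leq_max leqnn.
Qed.

End coefficients.

(** * Existence of the expansion *)
Section scaling.
Variable R : realType.
Local Notation normc := Normc.normc.
Local Notation C := (Cplx R).

Lemma scale_cont (s : R) : continuous (fun w : C => s%:C * w : C).
Proof.
by move=> w; apply: (@cvgM C _ (nbhs w)); [exact: cvg_cst|exact: cvg_id].
Qed.

(** Compactness of the closed disk leaves room for a slightly larger disk inside
    the domain of [f]; rescaling it to the unit disk makes the Cauchy formula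
    over the unit circle available for the larger one. *)
Lemma hol_cdisk_scale (f : C -> C) : hol_cdisk f ->
  exists2 s : R, 1 < s & hol_cdisk (fun w => f (s%:C * w)).
Proof.
move=> [U [oU DU dU]].
have cover : \forall s \near (1 : R), @closed_disk R `<=` (fun w : C => U (s%:C * w)).
  have nc := (@compact_near_coveringP _ (@closed_disk R)).1 (@closed_disk_compact R).
  apply: (nc R (nbhs (1 : R)) (fun s w => U (s%:C * w)) _) => w Dw.
  have cm : (fun p : C * R => p.2%:C * p.1 : C) @ (w, 1 : R) --> (w : C).
    rewrite -[X in _ --> X]mul1r.
    apply: (@cvgM C _ (nbhs (w, 1 : R))); last exact: cvg_fst.
    apply: (@cvg_comp _ _ _ snd (fun s : R => s%:C : C)); first exact: cvg_snd.
    by have := @continuous_realC R 1.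
  apply: cm; apply: open_nbhs_nbhs; split=> //; exact: DU.
have [d /= d0 hd] : nbhs_ball (1 : R)
    [set s : R | @closed_disk R `<=` (fun w : C => U (s%:C * w))].
  exact/nbhs_ballP.
exists (1 + d / 2); first by rewrite ltrDl divr_gt0.
set s := 1 + d / 2.
exists [set w : C | U (s%:C * w)]; split.
- by apply: (@open_comp C C (fun w => s%:C * w) U _ oU) => w _; exact: scale_cont.
- have sb : ball (1 : R) d s.
    rewrite /ball /= /s opprD addrA subrr sub0r normrN gtr0_norm ?divr_gt0//.
    by rewrite ltr_pdivrMr// ltr_pMr// ltr1n.
  have hs := hd s sb; exact: hs.
- move=> w /= Uw; apply/derivable1_diffP.
  apply: (@differentiable_comp _ _ _ _ (fun w : C => s%:C * w : C) f).
    apply/derivable1_diffP.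
    by apply: derivableM; [exact: derivable_cst|exact: derivable_id].
  by apply/derivable1_diffP; exact: dU.
Qed.

End scaling.

Section divergence.
Variable R : realType.

(** An elementary substitute for the exponential bound on the product: it forces
    the product to 0 as soon as the sum diverges. *)
Lemma prod_one_sub_le (u : nat -> R) N :
  (forall k, (1 <= k)%N -> 0 <= u k <= 1) ->
  \prod_(1 <= k < N.+1) (1 - u k) * (1 + \sum_(1 <= k < N.+1) u k) <= 1.
Proof.
move=> u01.
have S0 n : 0 <= \sum_(1 <= k < n.+1) u k.
  by rewrite big_nat sumr_ge0// => k /andP[k1 _]; have /andP[] := u01 k k1.
have P0 n : 0 <= \prod_(1 <= k < n.+1) (1 - u k).
  rewrite big_nat prodr_ge0// => k /andP[k1 _]; have /andP[_] := u01 k k1.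
  by rewrite subr_ge0.
elim: N => [|N IH]; first by rewrite !big_geq// addr0 mul1r.
rewrite !(big_nat_recr N.+1)//=; apply: le_trans IH.
rewrite -mulrA ler_wpM2l//.
have /andP[u0 u1] := u01 N.+1 isT.
have := S0 N; set S := \sum_(_ <= _ < _) _; nra.
Qed.

Lemma series_pinfty_gt (u : nat -> R) : (forall k, (1 <= k)%N -> 0 <= u k) ->
  (\sum_(1 <= k <oo) (u k)%:E = +oo)%E ->
  forall A : R, \forall N \near \oo, A < \sum_(1 <= k < N) u k.
Proof.
move=> u0 du A.
have [n hn] : exists n, A < \sum_(1 <= k < n) u k.
  apply: contrapT => /forallNP H.
  have : (\sum_(1 <= k <oo) (u k)%:E <= A%:E)%E.
    apply: lime_le; first by apply: is_cvg_nneseries_cond => k k1 _; rewrite lee_fin u0.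
    apply: nearW => n; rewrite sumEFin lee_fin.
    by rewrite leNgt; apply/negP; exact: H.
  by rewrite du leye_eq.
exists n => // N /= nN; apply: (lt_le_trans hn).
have ge0 m p : (1 <= m)%N -> 0 <= \sum_(m <= k < p) u k.
  move=> m1; rewrite big_nat; apply: sumr_ge0 => k /andP[mk _]; exact: u0 (leq_trans m1 mk).
have [n1|n1] := leqP n 1; first by rewrite (big_geq n1) ge0.
by rewrite (big_cat_nat (ltnW n1) nN) /= lerDl ge0// ltnW.
Qed.

End divergence.

Section existence.
Variable R : realType.
Local Notation normc := Normc.normc.
Local Notation C := (Cplx R).
Variable lam : nat -> C.
Hypothesis hlam : forall k, (1 <= k)%N -> unit_disk (lam k).

Let lam1 k : (1 <= k)%N -> normc (lam k) < 1.
Proof. by move=> /hlam; rewrite unit_diskE. Qed.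

(** This is 1 / B_n with each factor inverted separately: B_n may have poles in
    the region [1 < |w|], whereas the denominators here do not vanish in it. *)
Definition inv_blaschke n (w : C) : C :=
  \prod_(1 <= k < n.+1) ((1 - conjc (lam k) * w) / (lam k - w)).

(** The function 1 / (B_(n-1)(w) (w - lambda_n)), with value 0 for [n = 0], so
    that the formula for [kernel_coef] covers the first coefficient. *)
Definition malmquist n (w : C) : C :=
  if n is m.+1 then inv_blaschke m w / (w - lam n) else 0.

Definition kernel_coef n (w : C) : C := malmquist n.+1 w - conjc (lam n) * malmquist n w.

Lemma inv_blaschkeS n w : inv_blaschke n.+1 w =
  inv_blaschke n w * ((1 - conjc (lam n.+1) * w) / (lam n.+1 - w)).
Proof. by rewrite /inv_blaschke big_nat_recr. Qed.

Lemma outer_sub_neq0 (x w : C) : normc x <= 1 -> 1 < normc w -> w - x != 0.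
Proof.
move=> x1 w1; rewrite subr_eq0; apply/eqP => E; move: w1.
by rewrite E ltNge x1.
Qed.

(** The expansion of the Cauchy kernel with its remainder.  It comes from
    telescoping 1 - B_N(z) / B_N(w) over the factors and from
    (1 - |l|^2) / (1 - conj l z) = 1 - conj l b(z) for a single factor b.  The
    remainder is governed by 1 / B_N(w). *)
Lemma kernel_expansion (z w : C) N : normc z <= 1 -> 1 < normc w ->
  (w - z)^-1 - \sum_(0 <= n < N.+1) kernel_coef n w * blaschke lam n z =
  blaschke lam N z * inv_blaschke N w * ((w - z)^-1 - (w - lam N.+1)^-1).
Proof.
move=> z1 w1.
have wz := outer_sub_neq0 z1 w1.
have wl k : w - lam k.+1 != 0 by apply: outer_sub_neq0 => //; apply/ltW/lam1.
elim: N => [|N IH].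
  rewrite big_nat1 blaschke0 /inv_blaschke big_geq// /kernel_coef /malmquist.
  by rewrite mulr0 subr0 /inv_blaschke big_geq// !mul1r mulr1.
rewrite big_nat_recr//= opprD addrA IH blaschkeS /kernel_coef /malmquist !inv_blaschkeS.
have lz := blaschke_den_neq0 (lam1 (ltn0Sn N)) z1.
have w2 := wl N; have w3 := wl N.+1.
have w2' : lam N.+1 - w != 0 by rewrite -opprB oppr_eq0.
move: (blaschke lam N z) (inv_blaschke N w) => B Q.
move: lz w2 w3 w2'; move: (lam N.+1) (lam N.+2) => l l'.
move: (conjc l) => lb lz w2 w3 w2'.
by field; rewrite wz w2 w3 lz w2'.
Qed.

(** By [blaschke_factor_sqr] the square is 1 - (1 - |l|^2)(s^2 - 1) / |l - w|^2;
    then use |l - w| <= s + 1 and 1 - |l| <= 1 - |l|^2. *)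
Lemma inv_blaschke_factor_le (l w : C) (s : R) : normc l < 1 -> 1 < s ->
  normc w = s ->
  normc ((1 - conjc l * w) / (l - w)) ^+ 2 <= 1 - (s - 1) / (s + 1) * (1 - normc l).
Proof.
move=> l1 s1 ws.
have wl : l - w != 0.
  by rewrite -opprB oppr_eq0; apply: outer_sub_neq0; rewrite ?ws// ltW.
have D0 : 0 < normc (l - w) ^+ 2 by rewrite exprn_gt0// normc_gt0.
rewrite Normc.normcM Normc.normcV exprMn exprVn ler_pdivrMr//.
have := blaschke_factor_sqr l w; rewrite ws => E.
have Dle : normc (l - w) ^+ 2 <= (s + 1) ^+ 2.
  rewrite ler_pXn2r ?nnegrE ?normc_ge0//; last by lra.
  by apply: (le_trans (ler_normcD _ _)); rewrite normcN ws; lra.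
have -> : normc (1 - conjc l * w) ^+ 2 =
    normc (l - w) ^+ 2 - (1 - normc l ^+ 2) * (s ^+ 2 - 1).
  by apply/eqP; rewrite -subr_eq0; apply/eqP; move: E; lra.
move: D0 Dle; move: (normc (l - w) ^+ 2) => D D0 Dle.
have l0 := normc_ge0 l; move: l1 l0; move: (normc l) => r r1 r0.
have s10 : 0 < s + 1 by lra.
suff : (s - 1) / (s + 1) * (1 - r) * D <= (1 - r ^+ 2) * (s ^+ 2 - 1) by lra.
apply: (@le_trans _ _ ((s - 1) / (s + 1) * (1 - r) * (s + 1) ^+ 2)).
  rewrite ler_wpM2l// !mulr_ge0 ?invr_ge0//; lra.
have -> : (s - 1) / (s + 1) * (1 - r) * (s + 1) ^+ 2 = (1 - r) * (s ^+ 2 - 1).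
  by field; rewrite gt_eqF.
rewrite ler_wpM2r//; nra.
Qed.

Lemma inv_blaschke_le (s : R) N (w : C) : 1 < s -> normc w = s ->
  normc (inv_blaschke N w) ^+ 2 <=
  (1 + (s - 1) / (s + 1) * \sum_(1 <= k < N.+1) (1 - normc (lam k)))^-1.
Proof.
move=> s1 ws; set c := (s - 1) / (s + 1).
have s10 : 0 < s + 1 by lra.
have c0 : 0 <= c by rewrite divr_ge0//; lra.
have c1 : c <= 1 by rewrite ler_pdivrMr//; lra.
pose u k := c * (1 - normc (lam k)).
have u01 k : (1 <= k)%N -> 0 <= u k <= 1.
  move=> /lam1 k1; have k0 := normc_ge0 (lam k).
  have d0 : 0 <= 1 - normc (lam k) by rewrite subr_ge0 ltW.
  by rewrite /u mulr_ge0// mulr_ile1// gerBl.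
have h := prod_one_sub_le N u01.
have E : 1 + c * \sum_(1 <= k < N.+1) (1 - normc (lam k)) =
         1 + \sum_(1 <= k < N.+1) u k by rewrite mulr_sumr.
have S0 : 0 <= \sum_(1 <= k < N.+1) u k.
  by rewrite big_nat sumr_ge0// => k /andP[k1 _]; have /andP[] := u01 k k1.
rewrite E -[leRHS]mul1r ler_pdivlMr ?ltr_wpDr//.
apply: le_trans h; rewrite ler_wpM2r ?addr_ge0//.
elim: N {E S0} => [|N IH].
  by rewrite /inv_blaschke !big_geq// Normc.normc1 expr1n.
rewrite inv_blaschkeS Normc.normcM exprMn [leRHS]big_nat_recr//=.
rewrite ler_pM ?sqr_ge0//; exact: inv_blaschke_factor_le (lam1 _) s1 ws.
Qed.

Lemma circle_cont_inv_blaschke (s : R) N : 1 < s ->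
  circle_cont (fun w => inv_blaschke N (s%:C * w)).
Proof.
move=> s1; have cs : circle_cont (fun w => s%:C * w).
  by apply: circle_contM; [exact: circle_cont_cst|exact: circle_cont_id].
elim: N => [|N IH].
  have -> : (fun w => inv_blaschke 0 (s%:C * w)) = fun=> 1.
    by apply/funext => w; rewrite /inv_blaschke big_geq.
  exact: circle_cont_cst.
have -> : (fun w => inv_blaschke N.+1 (s%:C * w)) =
    (fun w => inv_blaschke N (s%:C * w) *
       ((1 - conjc (lam N.+1) * (s%:C * w)) / (lam N.+1 - s%:C * w))).
  by apply/funext => w; rewrite inv_blaschkeS.
apply: circle_contM IH _; apply: circle_contM.
  apply: circle_contB; first exact: circle_cont_cst.
  by apply: circle_contM cs; exact: circle_cont_cst.
apply: circle_contV; first by apply: circle_contB cs; exact: circle_cont_cst.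
move=> w w1; rewrite -opprB oppr_eq0; apply: outer_sub_neq0.
  exact/ltW/lam1.
by rewrite Normc.normcM normc_real w1 mulr1 gtr0_norm//; lra.
Qed.

Lemma circle_cont_outerV (s : R) (x : C) : 1 < s -> normc x <= 1 ->
  circle_cont (fun w => (s%:C * w - x)^-1).
Proof.
move=> s1 x1; apply: circle_contV.
  apply: circle_contB; last exact: circle_cont_cst.
  by apply: circle_contM; [exact: circle_cont_cst|exact: circle_cont_id].
move=> w w1; apply: outer_sub_neq0 => //.
by rewrite Normc.normcM normc_real w1 mulr1 gtr0_norm//; lra.
Qed.

Lemma circle_cont_kernel_coef (s : R) n : 1 < s ->
  circle_cont (fun w => kernel_coef n (s%:C * w)).
Proof.
move=> s1; have cw m : circle_cont (fun w => malmquist m (s%:C * w)).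
  case: m => [|m]; first exact: circle_cont_cst.
  apply: circle_contM; first exact: circle_cont_inv_blaschke.
  by apply: circle_cont_outerV => //; apply/ltW/lam1.
apply: circle_contB (cw _) _; apply: circle_contM (cw _); exact: circle_cont_cst.
Qed.

(** Average [kernel_expansion] against [f] over a circle of radius [s > 1].  The
    remainder tends to 0 uniformly in [z] because 1 / B_N tends to 0 uniformly
    on that circle, by divergence of the sum of the 1 - |lambda_k|. *)
Lemma expansion_exists (f : C -> C) : hol_cdisk f ->
  (\sum_(1 <= k <oo) (1 - normc (lam k))%:E = +oo)%E ->
  exists a : nat -> C, forall e : R, 0 < e -> \forall N \near \oo,
    forall z, normc z <= 1 ->
    normc (f z - \sum_(0 <= n < N) a n * blaschke lam n z) < e.
Proof.
move=> hf hdiv; have [s s1 hg] := hol_cdisk_scale hf.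
set g := (fun w => f (s%:C * w)) in hg.
have cg := circle_cont_hol hg.
have s0 : 0 < s by lra.
have cs : circle_cont (fun w => s%:C * w).
  by apply: circle_contM; [exact: circle_cont_cst|exact: circle_cont_id].
have ns w : normc w = 1 -> normc (s%:C * w) = s.
  by move=> w1; rewrite Normc.normcM normc_real w1 mulr1 gtr0_norm.
pose h n w := g w * (s%:C * w * kernel_coef n (s%:C * w)).
have ch n : circle_cont (h n).
  apply: circle_contM cg _; apply: circle_contM cs _; exact: circle_cont_kernel_coef.
have [M M0 gM] := circle_bounded cg.
have s10 : 0 < s - 1 by lra.
exists (fun n => circle_integral (h n)) => e e0.
(* Up to the sup of 1 / B_N, this bounds the mean of the remainder: the factors
   bound the mean, [f], the point of integration and the difference of the two
   kernels in turn. *)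
set K := 2 * (M * (s * (2 / (s - 1)))).
have K0 : 0 < K by rewrite /K !mulr_gt0// invr_gt0.
have c0 : 0 < (s - 1) / (s + 1) by rewrite divr_gt0//; lra.
have eK : 0 < (e / (2 * K)) ^+ 2 by rewrite exprn_gt0// divr_gt0// mulr_gt0.
have u0 k : (1 <= k)%N -> 0 <= 1 - normc (lam k).
  by move=> k1; rewrite subr_ge0; apply/ltW/lam1.
(* The partial sum of the 1 - |lambda_k| that makes the square in
   [inv_blaschke_le] smaller than (e / 2K)^2. *)
have [N0 _ hN0] := series_pinfty_gt u0 hdiv
  (((e / (2 * K)) ^+ 2)^-1 / ((s - 1) / (s + 1))).
exists N0.+1 => // -[//|N] /= NN z z1.
have hN := hN0 N.+1 (leq_trans (leqnSn _) NN).
have Qle w : normc w = 1 -> normc (inv_blaschke N (s%:C * w)) <= e / (2 * K).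
  move=> w1; have q := inv_blaschke_le N s1 (ns w w1).
  rewrite -(@ler_pXn2r _ 2)// ?nnegrE ?normc_ge0//; last first.
    by rewrite divr_ge0 ?ltW// mulr_gt0.
  apply: (le_trans q); rewrite -[leRHS]invrK lef_pV2 ?posrE ?invr_gt0//.
    by apply/ltW; move: hN; rewrite ltr_pdivrMr// mulrC; lra.
  rewrite ltr_wpDr// mulr_ge0 ?(ltW c0)// big_nat sumr_ge0// => k /andP[k1 _].
  exact: u0.
have zs : normc (z / s%:C) < 1.
  rewrite Normc.normcM Normc.normcV normc_real gtr0_norm// ltr_pdivrMr// mul1r.
  by lra.
have sC0 : s%:C != 0 :> C by rewrite -normc_eq0 normc_real normr_eq0 gt_eqF.
have fz : f z = cauchy g (z / s%:C).
  by rewrite (cauchy_formula hg zs) /g mulrCA mulfV// mulr1.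
pose Bh n (w : C) := blaschke lam n z * h n w.
have cBh n : circle_cont (Bh n).
  by apply: circle_contM (ch n); exact: circle_cont_cst.
have [cSum SumE] := circle_integral_sum N.+1 cBh.
have sumE : \sum_(0 <= n < N.+1) circle_integral (h n) * blaschke lam n z =
    circle_integral (fun w => \sum_(0 <= n < N.+1) Bh n w).
  rewrite SumE; apply: eq_bigr => n _.
  by rewrite (circle_integralZ _ (ch n)) mulrC.
have cgk := circle_contM cg (circle_cont_kernel zs).
rewrite sumE fz /cauchy -(circle_integralB cgk cSum).
pose E w := g w * (s%:C * w * (blaschke lam N z * inv_blaschke N (s%:C * w) *
   ((s%:C * w - z)^-1 - (s%:C * w - lam N.+1)^-1))).
have lN : normc (lam N.+1) <= 1 by apply/ltW/lam1.
have cE : circle_cont E.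
  apply: circle_contM cg _; apply: circle_contM cs _; apply: circle_contM.
    by apply: circle_contM; [exact: circle_cont_cst|exact: circle_cont_inv_blaschke].
  by apply: circle_contB; exact: circle_cont_outerV.
rewrite (@eq_circle_integral _ _ E); last first.
  move=> w w1; rewrite /E.
  have w1' : 1 < normc (s%:C * w) by rewrite ns.
  rewrite -(kernel_expansion N z1 w1').
  have -> : \sum_(0 <= n < N.+1) Bh n w = g w * (s%:C * w *
      \sum_(0 <= n < N.+1) kernel_coef n (s%:C * w) * blaschke lam n z).
    rewrite !mulr_sumr; apply: eq_bigr => n _; rewrite /Bh /h.
    move: (g w) (kernel_coef _ _) (blaschke _ _ _) => G X Y; ring.
  have wz := outer_sub_neq0 z1 w1'.
  move: (\sum_(_ <= _ < _) _) (g w) => S G.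
  have -> : w / (w - z / s%:C) = s%:C * w * (s%:C * w - z)^-1.
    by field; rewrite sC0 wz.
  by ring.
have K2 : 2 * (M * (s * (e / (2 * K) * (2 / (s - 1))))) = e / 2.
  rewrite [LHS](_ : _ = K * (e / (2 * K))); last by rewrite /K; ring.
  by field; rewrite gt_eqF.
apply: (@le_lt_trans _ _ (e / 2)); last by rewrite ltr_pdivrMr// ltr_pMr// ltr1n.
rewrite -K2; apply: (circle_integral_bound cE) => t ht.
have w1 := normc_expi t; set w := expi t in w1 *.
rewrite /E Normc.normcM ler_pM ?normc_ge0//; first exact: gM.
rewrite Normc.normcM (ns _ w1) ler_wpM2l ?(ltW s0)//.
rewrite Normc.normcM ler_pM ?normc_ge0//.
  rewrite Normc.normcM -[leRHS]mul1r ler_pM ?normc_ge0 ?Qle//.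
  exact: blaschke_le1.
have outV x : normc x <= 1 -> normc ((s%:C * w - x)^-1) <= (s - 1)^-1.
  move=> x1; rewrite Normc.normcV.
  have := ler_normcB (s%:C * w) x; rewrite (ns _ w1) => d.
  have dd : s - 1 <= normc (s%:C * w - x) by lra.
  by rewrite lef_pV2 ?posrE//; lra.
apply: (le_trans (ler_normcD _ _)); rewrite normcN.
have -> : 2 / (s - 1) = (s - 1)^-1 + (s - 1)^-1 by ring.
by apply: lerD; exact: outV.
Qed.

End existence.

(** * Uniform convergence and the Schauder basis *)
Section convergence.
Variable R : realType.
Local Notation normc := Normc.normc.
Local Notation C := (Cplx R).

Definition disk_cvg (F : nat -> C -> C) (f : C -> C) :=
  forall e : R, 0 < e -> \forall N \near \oo,
    forall z, normc z <= 1 -> normc (f z - F N z) < e.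

Lemma uniform_cvgP (F : nat -> C -> C) (f : C -> C) :
  {uniform @closed_disk R, F @ \oo --> f} <-> disk_cvg F f.
Proof.
split.
  move=> H e e0.
  pose P := [set h : C -> C | forall z, normc z <= 1 -> normc (f z - h z) < e].
  suff : nbhs (f : {uniform` @closed_disk R -> C}) P by move=> /H.
  apply/uniform_nbhs; exists [set xy : C * C | ball xy.1 e%:C xy.2]; split.
    by rewrite -entourage_ballE; exists e%:C => //=; rewrite ltcR.
  move=> h hh z z1; have := hh z; rewrite closed_diskE => /(_ z1) /=.
  by rewrite -ball_normE /= normc_re ltcR.
move=> H P /uniform_nbhs[E [entE EP]].
move: entE; rewrite -entourage_ballE => -[e /= e0 eE].
have eR : (complex.Re e)%:C = e by rewrite RRe_real// gtr0_real.
have re0 : 0 < complex.Re e by rewrite -ltcR eR.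
apply: filterS (H _ re0) => N hN; apply: EP => z; rewrite closed_diskE => z1.
by apply: eE => /=; rewrite -ball_normE /= normc_re -eR ltcR; exact: hN.
Qed.

Lemma hol_cdisk_sum (u : nat -> C -> C) (a : nat -> C) N :
  (forall n, hol_cdisk (u n)) ->
  hol_cdisk (fun z => \sum_(0 <= n < N) a n * u n z).
Proof.
move=> hu; elim: N => [|N IH].
  have -> : (fun z => \sum_(0 <= n < 0) a n * u n z) = fun=> 0.
    by apply/funext => z; rewrite big_geq.
  exact: hol_cdisk_cst.
have -> : (fun z => \sum_(0 <= n < N.+1) a n * u n z) =
    a N *: u N + (fun z => \sum_(0 <= n < N) a n * u n z).
  by apply/funext => z; rewrite big_nat_recr//= addrC.
exact: (hol_cdisk_lin (a N) (hu N) IH).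
Qed.

Lemma hol_cdisk_le (f : C -> C) (e : R) : hol_cdisk f ->
  (forall z, normc z < 1 -> normc (f z) <= e) ->
  forall z, normc z <= 1 -> normc (f z) <= e.
Proof.
move=> hf fe z z1; apply/ler_addgt0Pr => d d0.
have cz : {for z, continuous f} by apply: hol_cdisk_continuous; rewrite ?closed_diskE.
have /cplx_continuousP /(_ _ d0) /near_normc[r r0 hr] := cz.
pose t := Num.min (r / 2) (1 / 2).
have t0 : 0 < t by rewrite lt_min !divr_gt0.
have t1 : t < 1 by rewrite gt_min; apply/orP; right; lra.
have tr : t < r by rewrite gt_min; apply/orP; left; lra.
pose w : C := (1 - t)%:C * z.
have w1 : normc w < 1.
  rewrite Normc.normcM normc_real ger0_norm; last by lra.
  have : (1 - t) * normc z <= (1 - t) * 1 by rewrite ler_wpM2l//; lra.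
  by lra.
have wz : normc (w - z) < r.
  have -> : w - z = - (t%:C * z) by rewrite /w rmorphB rmorph1 /=; ring.
  rewrite normcN Normc.normcM normc_real gtr0_norm//.
  by apply: le_lt_trans tr; rewrite ler_piMr// ltW.
have := hr _ wz; have := fe _ w1; have := ler_normcD (f z - f w) (f w).
by rewrite subrK; lra.
Qed.

Lemma hol_fun_sum (a : nat -> C) (x_ : nat -> Hol R) N z :
  (\sum_(0 <= n < N) a n *: x_ n) z = \sum_(0 <= n < N) a n * x_ n z.
Proof.
elim: N => [|N IH]; first by rewrite !big_geq.
by rewrite !big_nat_recr//= -IH.
Qed.

(** The norm only sees the open disk, but a bound there extends to the closed
    disk by continuity ([hol_cdisk_le]). *)
Lemma hol_cvgP (F : C -> C) (u : nat -> C -> C) (hu : forall n, hol_cdisk (u n))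
    (x : Hol R) (a : nat -> C) : hol_cdisk F -> (forall z, x z = F (val z)) ->
  (fun N => \sum_(0 <= n < N) a n *: hol_of (hu n)) @ \oo --> x <->
  disk_cvg (fun N z => \sum_(0 <= n < N) a n * u n z) F.
Proof.
move=> hF xF.
have E N z : (x - \sum_(0 <= n < N) a n *: hol_of (hu n)) z =
    F (val z) - \sum_(0 <= n < N) a n * u n (val z).
  by rewrite -xF -(hol_fun_sum a (fun n => hol_of (hu n))).
split=> [H e e0|H].
  have e20 : 0 < e / 2 by rewrite divr_gt0.
  have eC : 0 < (e / 2)%:C by rewrite ltcR.
  have near_norm : \forall N \near \oo,
      (hol_norm (x - \sum_(0 <= n < N) a n *: hol_of (hu n)))%:C < (e / 2)%:C.
    exact: (@cvgr_dist_lt _ (Hol R) _ \oo _ _ x H _ eC).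
  apply: filterS near_norm => N; rewrite ltcR => hN z z1.
  have hG : hol_cdisk (fun z => F z - \sum_(0 <= n < N) a n * u n z).
    have := hol_cdisk_lin (-1) (hol_cdisk_sum a N hu) hF.
    by congr hol_cdisk; apply/funext => w; rewrite !fctE scaleN1r addrC.
  apply: (@le_lt_trans _ _ (e / 2)); last by rewrite ltr_pdivrMr// ltr_pMr// ltr1n.
  apply: (hol_cdisk_le hG _ z1) => w w1.
  have w1' : `|w| <= 1 by rewrite normc_re (lecR _ 1) ltW.
  have -> : F w - \sum_(0 <= n < N) a n * u n w =
    (x - \sum_(0 <= n < N) a n *: hol_of (hu n)) (exist _ w w1') by rewrite E.
  by apply: le_trans (ltW hN); apply: hol_norm_ub; rewrite unit_diskE.
apply/(@cvgrPdist_lt _ (Hol R) _ \oo) => e e0.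
have eR : (complex.Re e)%:C = e by rewrite RRe_real// gtr0_real.
have re0 : 0 < complex.Re e / 2 by rewrite divr_gt0// -ltcR eR.
apply: filterS (H _ re0) => N hN; rewrite -eR ltcR.
apply: (@le_lt_trans _ _ (complex.Re e / 2)); last by move: re0; lra.
apply: hol_norm_le => z; rewrite unit_diskE => z1.
by rewrite E; apply/ltW/hN/ltW.
Qed.

End convergence.

Theorem theorem5p1 (R : realType) (lam : nat -> Cplx R)
    (hlam : forall k : nat, (1 <= k)%N -> unit_disk (lam k))
    (hdiv : (\sum_(1 <= k <oo) (1 - Normc.normc (lam k))%:E = +oo)%E) :
  (forall f : Cplx R -> Cplx R, hol_cdisk f ->
    let expands (a : nat -> Cplx R) :=
      {uniform @closed_disk R,
        (fun (N : nat) (z : Cplx R) =>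
          \sum_(0 <= n < N) a n * blaschke lam n z) @ \oo --> f} in
    (exists! a : nat -> Cplx R, expands a) /\
    (forall a : nat -> Cplx R, expands a -> forall n : nat,
      a n = toeplitz (fun zeta => conjc (blaschke lam n zeta)) f (lam n.+1)
        - (if n is m.+1 then
             conjc (lam n) * toeplitz (fun zeta => conjc (blaschke lam m zeta)) f (lam n)
           else 0))) /\
  schauder_basis (fun n : nat => hol_of (hol_cdisk_blaschke hlam n)).
Proof.
have uniq (f : Cplx R -> Cplx R) (hf : hol_cdisk f) : exists! a : nat -> Cplx R,
    disk_cvg (fun N z => \sum_(0 <= n < N) a n * blaschke lam n z) f.
  have [a ha] := expansion_exists hlam hf hdiv.
  exists a; split=> // b hb; apply/funext => n.
  by rewrite (blaschke_coef_unique hlam hf ha) (blaschke_coef_unique hlam hf hb).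
split=> [f hf expands|x].
  have [a [ha a_uniq]] := uniq f hf.
  split; first by exists a; split=> [|b /uniform_cvgP]; [exact/uniform_cvgP|exact: a_uniq].
  move=> b /uniform_cvgP hb n; rewrite (blaschke_coef_unique hlam hf hb n) /blaschke_coef.
  by rewrite (toeplitz_coefE hlam n hf); case: n => // n; rewrite toeplitz_coefE.
have := hol_funP x; rewrite inE => -[F hF xF].
have [a [ha a_uniq]] := uniq F hF.
exists a; split; first exact/(hol_cvgP _ a hF xF).
by move=> b /(hol_cvgP _ b hF xF); exact: a_uniq.
Qed.
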